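(* Let $N$ be a smooth manifold, let $Q$ be a positive definite $C^{2}$ quadratic form on $TN$, and let $\rho$ be the Riemannian metric on $N$ with $Q_x(v)=\Vert v\Vert_x^{2}/2$. Let $k\ge 1$ with $k<\dim N$, let $g:\mathbb{R}^{k}\to\mathbb{R}$ be a $C^{2}$ nonnegative function vanishing only at the origin, and let $F=(F_1,\ldots,F_k):N\to\mathbb{R}^{k}$ be a $C^{3}$ function such that $\mathbf{0}$ is a regular value of $F$, the vector fields $\nabla_\rho F_i/\Vert\nabla_\rho F_i\Vert^{2}$ pairwise commute, and $$\langle \nabla_\rho F_i,\nabla_\rho F_j\rangle_\rho\equiv 0,\qquad i\neq j.$$ Put $U=g\circ F$ and $M=U^{-1}(0)$. Then every point of $M\times\{\mathbf{0}\}\subset TN$ is a Lyapunov unstable equilibrium point of the Lagrangian dynamics (Euler-Lagrange flow on $TN$) of $L_{mech}(x,v)=Q_x(v)-U(x)$.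
   Context: $\nabla_\rho$ denotes the gradient with respect to $\rho$. The vector field $\nabla_\rho F_i/\Vert\nabla_\rho F_i\Vert^{2}$ is defined off the critical set of $F_i$, and commutation is understood wherever the fields are defined. $M\times\{\mathbf{0}\}$ is the set of $(x,\mathbf{0})\in TN$ with $x\in M$. An equilibrium point $(p,\mathbf{0})$ is Lyapunov stable if for every neighborhood $\mathcal{O}$ of it in $TN$ there is a neighborhood $\mathcal{O}'$ of it such that every solution $(x(t),\dot x(t))$ of the Euler-Lagrange equations with $(x(0),\dot x(0))\in\mathcal{O}'$ is defined and stays in $\mathcal{O}$ for all $t\ge 0$; it is Lyapunov unstable if it is not Lyapunov stable. *)

(* Defs.v *)
From HB Require Import structures.
From mathcomp Require Import all_boot all_order all_algebra.
From mathcomp Require Import all_classical all_reals all_analysis.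

Set Implicit Arguments.
Unset Strict Implicit.
Unset Printing Implicit Defensive.

Import Order.TTheory GRing.Theory Num.Theory numFieldNormedType.Exports.

Local Open Scope ring_scope.
Local Open Scope classical_set_scope.

(* [f] is of class C^m on the set [A], which is meant to be open. *)
Fixpoint Ck_on (R : realType) (n : nat) (W : normedModType R) (m : nat)
    (A : set 'rV[R]_n) (f : 'rV[R]_n -> W) : Prop :=
  if m is m'.+1 then
    (forall y, A y -> differentiable f y) /\
    (forall a : 'I_n, Ck_on m' A (fun y => 'D_(delta_mx 0 a) f y))
  else forall y, A y -> {for y, continuous f}.

(* A chart is a homeomorphism from the open set [chart_dom] of [X] onto the
   open set [chart_cod] of R^n; [phi] and [psi] are total functions, and their
   values outside these two sets are irrelevant. *)
Record chart (R : realType) (n : nat) (X : topologicalType) := Chart {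
  chart_dom : set X;
  chart_cod : set 'rV[R]_n;
  phi : X -> 'rV[R]_n;
  psi : 'rV[R]_n -> X;
  chart_dom_open : open chart_dom;
  chart_cod_open : open chart_cod;
  phi_cod : forall x, chart_dom x -> chart_cod (phi x);
  psi_dom : forall y, chart_cod y -> chart_dom (psi y);
  phiK : forall x, chart_dom x -> psi (phi x) = x;
  psiK : forall y, chart_cod y -> phi (psi y) = y;
  phi_continuous : forall x, chart_dom x -> {for x, continuous phi};
  psi_continuous : forall y, chart_cod y -> {for y, continuous psi}
}.

(* Smooth n-dimensional manifolds without boundary. The atlas need not be
   maximal. *)
Record smooth_manifold (R : realType) (n : nat) := SmoothManifold {
  manifold_space :> topologicalType;
  manifold_hausdorff : hausdorff_space manifold_space;
  manifold_second_countable : @second_countable manifold_space;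
  atlas_index : Type;
  atlas : atlas_index -> chart R n manifold_space;
  atlas_cover : forall x, exists i, chart_dom (atlas i) x;
  atlas_smooth : forall (i j : atlas_index) (m : nat),
    Ck_on m (chart_cod (atlas i) `&` psi (atlas i) @^-1` chart_dom (atlas j))
      (phi (atlas j) \o psi (atlas i))
}.

Section Manifold.
Context {R : realType} {n : nat} (N : smooth_manifold R n).
Implicit Types (x : N) (i : atlas_index N) (y w : 'rV[R]_n).

Definition chart_at x : chart R n N := atlas (sval (cid (atlas_cover x))).

(* The tangent space at [x] is R^n: a tangent vector is represented by its
   components in the chart [chart_at x]. [coord] and [tvec] convert to and from
   the components in an arbitrary chart around the base point. *)
Definition tangent (x : N) : Type := 'rV[R]_n.

Definition coord i x (v : tangent x) : 'rV[R]_n :=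
  'd (phi (atlas i) \o psi (chart_at x)) (phi (chart_at x) x) (v : 'rV[R]_n).

Definition tvec i y w : tangent (psi (atlas i) y) :=
  'd (phi (chart_at (psi (atlas i) y)) \o psi (atlas i)) y w.

Record tangent_bundle := TPoint { tbase : N; tvect : tangent tbase }.

HB.instance Definition _ := gen_eqMixin tangent_bundle.
HB.instance Definition _ := gen_choiceMixin tangent_bundle.

Definition bundle_chart i (z : 'rV[R]_n * 'rV[R]_n) : tangent_bundle :=
  TPoint (tvec i z.1 z.2).

(* The topology of TN: the final topology for the bundle charts
   chart_cod x R^n -> TN. *)
Definition bundle_open (O : set tangent_bundle) : Prop :=
  forall i, open [set z | chart_cod (atlas i) z.1 /\ O (bundle_chart i z)].

Let cylinder i : set ('rV[R]_n * 'rV[R]_n) :=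
  [set z | chart_cod (atlas i) z.1].

Let cylinder_open i : open (cylinder i).
Proof.
rewrite (_ : cylinder i = fst @^-1` chart_cod (atlas i)) //.
by apply: open_comp => [z _|]; [exact: cvg_fst|exact: chart_cod_open].
Qed.

Let bundle_openT : bundle_open setT.
Proof.
move=> i; rewrite (_ : [set z | _] = cylinder i); first exact: cylinder_open.
by apply/seteqP; split => z //= [].
Qed.

Let bundle_openI : setI_closed bundle_open.
Proof.
move=> A B oA oB i; rewrite (_ : [set z | _] =
  [set z | chart_cod (atlas i) z.1 /\ A (bundle_chart i z)] `&`
  [set z | chart_cod (atlas i) z.1 /\ B (bundle_chart i z)]); first exact: openI.
by apply/seteqP; split => z /=; tauto.
Qed.

Let bundle_open_bigU (I : Type) (f : I -> set tangent_bundle) :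
  (forall k, bundle_open (f k)) -> bundle_open (\bigcup_k f k).
Proof.
move=> of_ i; rewrite (_ : [set z | _] = \bigcup_k
  [set z | chart_cod (atlas i) z.1 /\ f k (bundle_chart i z)]).
  by apply: bigcup_open => k _; exact: of_.
apply/seteqP; split => z /=; first by move=> [? [k _ ?]]; exists k.
by move=> [k _ [? ?]]; split=> //; exists k.
Qed.

HB.instance Definition _ := isOpenTopological.Build tangent_bundle
  bundle_openT bundle_openI bundle_open_bigU.

Definition Ck (W : normedModType R) (m : nat) (f : N -> W) : Prop :=
  forall i, Ck_on m (chart_cod (atlas i)) (f \o psi (atlas i)).

Definition differential (W : normedModType R) (f : N -> W) x (v : tangent x) :
    W :=
  'd (f \o psi (chart_at x)) (phi (chart_at x) x) (v : 'rV[R]_n).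

Definition critical (W : normedModType R) (f : N -> W) : set N :=
  [set x | forall v : tangent x, differential f v = 0].

Definition regular_value (W : normedModType R) (f : N -> W) (z : W) : Prop :=
  forall x, f x = z -> forall u : W, exists v : tangent x, differential f v = u.

Definition vector_field : Type := forall x : N, tangent x.

Definition field_coord i (X : vector_field) y : 'rV[R]_n :=
  coord i (X (psi (atlas i) y)).

(* Components in the chart [i] of the Lie bracket [X, Y] at the point of
   coordinates [y]. *)
Definition lie_bracket i (X Y : vector_field) y : 'rV[R]_n :=
  'd (field_coord i Y) y (field_coord i X y) -
  'd (field_coord i X) y (field_coord i Y y).

Definition commute_on (A : set N) (X Y : vector_field) : Prop :=
  forall i y, chart_cod (atlas i) y -> A (psi (atlas i) y) ->
    lie_bracket i X Y y = 0.

(* The symmetric bilinear form with [polar Q v v = 2 * Q v], i.e. the scalar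
   product for which [Q v = |v|^2 / 2]. *)
Definition polar (Q : forall x, tangent x -> R) x (u v : tangent x) : R :=
  Q x (u + v) - Q x u - Q x v.

Definition quadratic_form (Q : forall x, tangent x -> R) : Prop :=
  forall x,
    (forall (a : R) (v : tangent x), Q x (a *: v) = a ^+ 2 * Q x v) /\
    (forall (a : R) (u u' v : tangent x),
      polar Q (a *: u + u') v = a * polar Q u v + polar Q u' v).

Definition positive_definite (Q : forall x, tangent x -> R) : Prop :=
  forall x (v : tangent x), v != 0 -> 0 < Q x v.

(* A quadratic form is C^m when its Gram matrices in the charts are. *)
Definition Ck_form (m : nat) (Q : forall x, tangent x -> R) : Prop :=
  forall i (a b : 'I_n), Ck_on m (chart_cod (atlas i))
    (fun y => polar Q (tvec i y (delta_mx 0 a)) (tvec i y (delta_mx 0 b))).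

Definition grad (Q : forall x, tangent x -> R) (f : N -> R) : vector_field :=
  fun x => xget 0
    [set w : tangent x | forall v, polar Q w v = differential f v].

(* grad f / |grad f|^2; its value 0 at the critical points is a dummy value. *)
Definition normalized_grad (Q : forall x, tangent x -> R) (f : N -> R) :
    vector_field :=
  fun x => (polar Q (grad Q f x) (grad Q f x))^-1 *: grad Q f x.

Definition velocity (c : R -> N) (t : R) : tangent (c t) :=
  (phi (chart_at (c t)) \o c)^`() t.

Definition lift (c : R -> N) (t : R) : tangent_bundle :=
  TPoint (velocity c t).

Definition C2_curve (c : R -> N) (J : set R) : Prop :=
  forall t, J t -> {for t, continuous c} /\
    forall i, chart_dom (atlas i) (c t) ->
      let q : R -> 'rV[R]_n := phi (atlas i) \o c in
      let q' : R -> 'rV[R]_n := q^`() in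
      [/\ derivable q t 1, derivable q' t 1 & {for t, continuous q'^`()}].

Definition local_lagrangian (L : forall x, tangent x -> R) i y w : R :=
  L (psi (atlas i) y) (tvec i y w).

(* [c] is a C^2 solution of the Euler-Lagrange equations
   d/dt (dL/dw_a (q, q')) = dL/dy_a (q, q') on the open set of times [J], in
   every chart; the values of [c] outside [J] are irrelevant. *)
Definition EL_solution (L : forall x, tangent x -> R) (c : R -> N)
    (J : set R) : Prop :=
  C2_curve c J /\
  forall t, J t -> forall i, chart_dom (atlas i) (c t) ->
    let q : R -> 'rV[R]_n := phi (atlas i) \o c in
    let q' : R -> 'rV[R]_n := q^`() in
    forall a : 'I_n,
      is_derive t 1
        (fun s => 'D_(delta_mx 0 a) (local_lagrangian L i (q s)) (q' s))
        ('D_(delta_mx 0 a) (fun y => local_lagrangian L i y (q' t)) (q t)).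

Definition equilibrium (L : forall x, tangent x -> R) (X : tangent_bundle) :
    Prop :=
  exists c, EL_solution L c setT /\ forall t, lift c t = X.

(* A solution is "defined for all t >= 0" when it extends to a solution on
   [0, +oo[. Intervals of definition are taken open, so they contain a
   neighborhood of the initial time 0. *)
Definition lyapunov_stable (L : forall x, tangent x -> R)
    (X : tangent_bundle) : Prop :=
  forall O : set tangent_bundle, nbhs X O ->
  exists2 O' : set tangent_bundle, nbhs X O' &
  forall (J : set R) (c : R -> N),
    open J -> is_interval J -> J 0 -> EL_solution L c J -> O' (lift c 0) ->
    exists c' : R -> N,
      [/\ EL_solution L c' (J `|` [set t | 0 <= t]),
          (forall t, J t -> c' t = c t) &
          (forall t, 0 <= t -> O (lift c' t))].

Definition lyapunov_unstable (L : forall x, tangent x -> R)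
    (X : tangent_bundle) : Prop := ~ lyapunov_stable L X.

End Manifold.

Arguments tangent {R n N} x.
Arguments TPoint {R n N} tbase tvect.

(* Main.v *)
(* Let [M] be the zero set of [F]. Fix a chart around [p], with Gram matrix [G]
   of the metric, and a nonzero vector [v] tangent to [M] at [p], which exists
   because k < n. Cramer's rule extends [v] to a C^1 field [xi] with
   dF(xi) = 0 near [p]. As [U] is a function of [F], the potential exerts no
   force along [xi], so [A = <q', xi(q)>] satisfies
   [A' = (1/2) (L_xi G)(q', q') = O(|q'|^2)] along a motion [q].

   Start at [p] with velocity [e v]. Since [U >= 0], conservation of energy
   gives [|q'| = O(e)] as long as [q] stays in a fixed small neighborhood, hence
   [A' = O(e^2)] and [A >= e |v|^2 / 2] for times up to [tau / e], where [tau]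
   does not depend on [e] or on the size [r] of the neighborhood. There [A]
   differs by [o(1) e], as [r] tends to 0, from the derivative of
   [<q - p, v>_p]. So the motion travels a distance bounded below by a constant
   in the direction of [v], and leaves the ball of radius [r] if [r] is small.

   As the definition of stability only speaks of existing solutions, one also
   needs a local solution with these initial data (Picard iteration in the
   chart), and the invariance of the Euler-Lagrange equations under changes of
   charts, which rests on the symmetry of second derivatives. *)

Require Import Defs.
From HB Require Import structures.
From mathcomp Require Import all_boot all_order all_algebra.
From mathcomp Require Import all_classical all_reals all_analysis.
From mathcomp Require Import ring lra.
Import Order.TTheory GRing.Theory Num.Theory numFieldNormedType.Exports.
Local Open Scope ring_scope.
Local Open Scope classical_set_scope.
Set Implicit Arguments.
Unset Strict Implicit.
Unset Printing Implicit Defensive.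

(** * Differential calculus *)

Section rows.
Context {R : realType} {n : nat}.
Implicit Types (v w : 'rV[R]_n).

Lemma ler_coord_norm v a : `|v 0 a| <= `|v|.
Proof.
rewrite [leRHS]/Num.Def.normr/= mx_normrE.
exact: (le_bigmax _ (fun ij : 'I_1 * 'I_n => `|v ij.1 ij.2|) (0, a)).
Qed.

Lemma rV_norm_le v e : 0 <= e -> (forall a, `|v 0 a| <= e) -> `|v| <= e.
Proof.
move=> e0 ve; rewrite [leLHS]/Num.Def.normr/= mx_normrE.
by apply: bigmax_le => // -[i a] _ /=; rewrite ord1.
Qed.

End rows.

Section curves.
Context {R : realType} {V W : normedModType R}.

Lemma is_derive_diff_comp (f : V -> W) (q : R -> V) (t : R) dq :
  differentiable f (q t) -> is_derive t 1 q dq ->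
  is_derive t 1 (f \o q) ('d f (q t) dq).
Proof.
move=> df [dqt <-]; have dq' : differentiable q t by apply/derivable1_diffP.
have dfq : differentiable (f \o q) t by exact: differentiable_comp.
apply: DeriveDef; first exact/derivable1_diffP.
by rewrite deriveE// diff_comp// deriveE.
Qed.

Lemma is_derive_affine (y v : V) (t : R) :
  is_derive t 1 (fun h => y + h *: v) v.
Proof.
have -> : (fun h : R => y + h *: v) = cst y + (fun h => h *: v) by [].
apply: (@is_derive_eq _ _ _ _ _ _ _ (0 + v)); last by rewrite add0r.
apply: is_deriveD; apply: DeriveDef.
  by apply/derivable1_diffP; apply: differentiableZl.
by rewrite deriveE ?diffZl//= ?diff_val ?scale1r//; apply: differentiableZl.
Qed.

Lemma is_derive_line (f : V -> W) (y v : V) (t : R) :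
  differentiable f (y + t *: v) ->
  is_derive t 1 (fun h => f (y + h *: v)) ('D_v f (y + t *: v)).
Proof.
move=> df; rewrite deriveE//.
by apply: (@is_derive_diff_comp f (fun h => y + h *: v)) => //; exact: is_derive_affine.
Qed.

End curves.

Section row_curves.
Context {R : realType} {n : nat}.

Lemma is_derive_rV (q : R -> 'rV[R]_n) (t : R) (dq : 'rV[R]_n) :
  (forall a, is_derive t 1 (fun s => q s 0 a) (dq 0 a)) -> is_derive t 1 q dq.
Proof.
move=> H; have dqt : derivable q t 1.
  by apply/derivable_mxP => i a; rewrite ord1; have [] := H a.
apply: DeriveDef => //; rewrite derive_mx//; apply/rowP => a; rewrite mxE.
by have [] := H a.
Qed.

Lemma is_derive_coord (q : R -> 'rV[R]_n) (t : R) (dq : 'rV[R]_n) a :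
  is_derive t 1 q dq -> is_derive t 1 (fun s => q s 0 a) (dq 0 a).
Proof.
move=> [dqt <-]; apply: DeriveDef; first by have/derivable_mxP := dqt; exact.
by rewrite derive_mx// mxE.
Qed.

Lemma diff_rV (W : normedModType R) (f : 'rV[R]_n -> W) y w :
  differentiable f y ->
  'd f y w = \sum_a w 0 a *: 'D_(delta_mx 0 a) f y.
Proof.
move=> df; rewrite {1}(row_sum_delta w) linear_sum.
by apply: eq_bigr => a _; rewrite linearZ/= deriveE.
Qed.

End row_curves.

(** * Functions bounded near a point together with their differentials *)

Section bounded_differential.
Context {R : realType}.
Implicit Types U V W : normedModType R.

(* The part of "C^1 near [x0]" that the estimates use: it is stable under algebra
   and composition, and holds of functions known explicitly only near [x0]. *)
Definition bounded_diff V W (f : V -> W) (x0 : V) : Prop := exists C : R,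
  \forall x \near x0, [/\ differentiable f x, `|f x| <= C &
                       forall v, `|'d f x v| <= C * `|v|].

Lemma bounded_diff_cst V W (c : W) (x0 : V) : bounded_diff (fun=> c) x0.
Proof.
exists `|c|; near=> x; split => // v.
by rewrite (diff_cst _ _) normr0 mulr_ge0.
Unshelve. all: by end_near. Qed.

Lemma bounded_diffD V W (f g : V -> W) x0 :
  bounded_diff f x0 -> bounded_diff g x0 -> bounded_diff (f \+ g) x0.
Proof.
move=> [C fC] [D gD]; exists (C + D); near=> x.
have [df fx dfC] : [/\ differentiable f x, `|f x| <= C &
  forall v, `|'d f x v| <= C * `|v|] by near: x.
have [dg gx dgD] : [/\ differentiable g x, `|g x| <= D &
  forall v, `|'d g x v| <= D * `|v|] by near: x.
split; first exact: differentiableD.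
  by rewrite (le_trans (ler_normD _ _))// lerD.
move=> v; rewrite (diffD df dg)/= mulrDl.
by rewrite (le_trans (ler_normD _ _))// lerD.
Unshelve. all: by end_near. Qed.

Lemma bounded_diffM V (f g : V -> R) x0 :
  bounded_diff f x0 -> bounded_diff g x0 -> bounded_diff (f \* g) x0.
Proof.
move=> [C fC] [D gD]; exists (C * D + C * D); near=> x.
have [df fx dfC] : [/\ differentiable f x, `|f x| <= C &
  forall v, `|'d f x v| <= C * `|v|] by near: x.
have [dg gx dgD] : [/\ differentiable g x, `|g x| <= D &
  forall v, `|'d g x v| <= D * `|v|] by near: x.
have C0 : 0 <= C by exact: le_trans fx.
have D0 : 0 <= D by exact: le_trans gx.
split; first exact: differentiableM.
  by rewrite /= normrM (le_trans (ler_pM _ _ fx gx))// lerDl mulr_ge0.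
move=> v; rewrite (diffM df dg).
rewrite -[X in `|X|]/(f x * 'd g x v + g x * 'd f x v) mulrDl.
rewrite (le_trans (ler_normD _ _))// !normrM lerD//.
  by rewrite -mulrA ler_pM.
by rewrite (mulrC C) -mulrA ler_pM.
Unshelve. all: by end_near. Qed.

Lemma bounded_diff_sum V W (I : Type) (r : seq I) (P : pred I) (f : I -> V -> W) x0 :
  (forall i, P i -> bounded_diff (f i) x0) -> bounded_diff (fun x => \sum_(i <- r | P i) f i x) x0.
Proof.
move=> H; elim: r => [|i r IH].
  by under eq_fun do rewrite big_nil; exact: bounded_diff_cst.
have [Pi|Pi] := boolP (P i).
  by under eq_fun do rewrite big_cons Pi; exact: (bounded_diffD (H i Pi) IH).
by under eq_fun do rewrite big_cons (negbTE Pi); exact: IH.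
Qed.

Lemma bounded_diff_prod V (I : Type) (r : seq I) (P : pred I) (f : I -> V -> R) x0 :
  (forall i, P i -> bounded_diff (f i) x0) -> bounded_diff (fun x => \prod_(i <- r | P i) f i x) x0.
Proof.
move=> H; elim: r => [|i r IH].
  by under eq_fun do rewrite big_nil; exact: bounded_diff_cst.
have [Pi|Pi] := boolP (P i).
  by under eq_fun do rewrite big_cons Pi; exact: (bounded_diffM (H i Pi) IH).
by under eq_fun do rewrite big_cons (negbTE Pi); exact: IH.
Qed.

Lemma bounded_diffN V W (f : V -> W) x0 : bounded_diff f x0 -> bounded_diff (\- f) x0.
Proof.
move=> [C fC]; exists C; near=> x.
have [df fx dfC] : [/\ differentiable f x, `|f x| <= C &
  forall v, `|'d f x v| <= C * `|v|] by near: x.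
split; [exact: differentiableN|by rewrite normrN|move=> v].
by rewrite (diffN df) -[X in `|X|]/(- 'd f x v) normrN.
Unshelve. all: by end_near. Qed.

Lemma bounded_diff_comp U V W (f : U -> V) (g : V -> W) x0 :
  bounded_diff f x0 -> bounded_diff g (f x0) -> bounded_diff (g \o f) x0.
Proof.
move=> [C fC] [D gD].
have cf : {for x0, continuous f}.
  by apply: differentiable_continuous; have [] := nbhs_singleton fC.
have {}gD := cf _ gD.
exists (`|C| * `|D| + `|D|); near=> x.
have [df fx dfC] : [/\ differentiable f x, `|f x| <= C &
  forall v, `|'d f x v| <= C * `|v|] by near: x.
have [dg gx dgD] : [/\ differentiable g (f x), `|g (f x)| <= D &
  forall v, `|'d g (f x) v| <= D * `|v|] by near: x.
have C0 : 0 <= C by exact: le_trans fx.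
have D0 : 0 <= D by exact: le_trans gx.
rewrite (ger0_norm C0) (ger0_norm D0).
split; first exact: differentiable_comp.
  by rewrite /= (le_trans gx)// lerDr mulr_ge0.
move=> v; rewrite (diff_comp df dg)/= (le_trans (dgD _))// mulrDl.
apply: (@le_trans _ _ (D * (C * `|v|))); first by rewrite ler_wpM2l.
by rewrite mulrA (mulrC C) lerDl mulr_ge0.
Unshelve. all: by end_near. Qed.

Lemma bounded_diffV V (f : V -> R) x0 :
  f x0 != 0 -> bounded_diff f x0 -> bounded_diff (fun x => (f x)^-1) x0.
Proof.
move=> f0 bf; apply: (@bounded_diff_comp _ _ _ f (fun z : R => z^-1)) => //.
(* Within |a| / 2 of [a] one has |z| >= |a| / 2, hence |1 / z| <= [C]; the differential of the
   inverse is then bounded by [C ^+ 2]. *)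
set a := f x0 in f0 *; pose C : R := 2 / `|a|; exists (C + C ^+ 2).
have a0 : 0 < `|a| by rewrite normr_gt0.
have C0 : 0 < C by rewrite divr_gt0.
near=> z.
have za : `|a| / 2 <= `|z|.
  have : `|a - z| <= `|a| / 2.
    near: z; have : \forall z \near a, ball a (`|a| / 2) z.
      by apply: nbhsx_ballx; rewrite divr_gt0.
    by apply: filterS => z; rewrite -ball_normE/= => /ltW.
  have := ler_normD (a - z) z; rewrite subrK.
  by lra.
have z0 : z != 0 by rewrite -normr_gt0; lra.
have zC : `|z^-1| <= C.
  by rewrite normfV /C -[leRHS]invf_div lef_pV2// posrE ?divr_gt0//; lra.
split; first exact: differentiable_Rinv.
  by rewrite (le_trans zC)// lerDl sqr_ge0.
move=> v; rewrite diff_Rinv// [_ *: _]/(_ * _) normrM ler_wpM2r//.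
rewrite normrN -exprVn normrX; apply: (@le_trans _ _ (C ^+ 2)).
  by rewrite ler_pXn2r// nnegrE ltW.
by rewrite lerDr ltW.
Unshelve. all: by end_near. Qed.

Lemma bounded_diff_lin V W (f : {linear V -> W}) x0 : continuous f -> bounded_diff f x0.
Proof.
move=> cf; have [k k0 fk] := linear_lipschitz cf.
exists (k * (`|x0| + 1) + k); near=> x; split.
- exact: linear_differentiable.
- apply: (le_trans (fk x)); apply: (@le_trans _ _ (k * (`|x0| + 1))); last first.
    by rewrite lerDl ltW.
  rewrite ler_pM2l//.
  have : `|x0 - x| <= 1.
    near: x; have : \forall z \near x0, ball x0 1 z by exact: nbhsx_ballx.
    by apply: filterS => z; rewrite -ball_normE/= => /ltW.
  have := ler_normB x0 (x0 - x); rewrite opprB addrC subrK; lra.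
- move=> v; rewrite diff_lin// (le_trans (fk v))// mulrDl lerDr.
  by rewrite !mulr_ge0// ?addr_ge0// ltW.
Unshelve. all: by end_near. Qed.

Lemma bounded_diff_continuous V W (f : V -> W) x0 : bounded_diff f x0 -> {for x0, continuous f}.
Proof.
by move=> [C fC]; apply: differentiable_continuous; have [] := nbhs_singleton fC.
Qed.

(** Mean value theorem on the segment from [y] to [x], which stays in the ball by convexity. One
    constant serves all small radii, so the ball can be shrunk further to meet other conditions. *)
Lemma bounded_diff_lipschitz V (f : V -> R) x0 : bounded_diff f x0 ->
  exists2 L : R, 0 <= L & \forall r \near 0^'+, forall x y,
    ball x0 r x -> ball x0 r y -> `|f x - f y| <= L * `|x - y|.
Proof.
move=> [C fC]; have C0 : 0 <= C.
  by have [_ fx _] := nbhs_singleton fC; exact: le_trans fx.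
exists C => //; have /nbhs_ballP[e /= e0 fe] := fC.
near=> r => x y xr yr.
have re : r <= e by near: r; exact: nbhs_right_le.
have seg (t : R) : 0 <= t <= 1 -> ball x0 e (y + t *: (x - y)).
  move=> /andP[t0 t1]; apply: (le_ball re).
  move: xr yr; rewrite -!ball_normE/= => xr yr.
  have -> : x0 - (y + t *: (x - y)) = t *: (x0 - x) + (1 - t) *: (x0 - y).
    have -> : x - y = (x0 - y) - (x0 - x).
      by rewrite opprB [RHS]addrC subrKA.
    by rewrite opprD addrA scalerBr opprB addrCA scalerBl scale1r.
  rewrite (le_lt_trans (ler_normD _ _))// !normrZ !ger0_norm ?subr_ge0//.
  have [->|tn0] := eqVneq t 0; first by rewrite mul0r add0r subr0 mul1r.
  have tp : 0 < t by rewrite lt_neqAle eq_sym tn0.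
  have : t * `|x0 - x| < t * r by rewrite ltr_pM2l.
  have : (1 - t) * `|x0 - y| <= (1 - t) * r by rewrite ler_wpM2l ?subr_ge0// ltW.
  by lra.
have df (t : R) : 0 <= t <= 1 ->
    is_derive t 1 (fun h => f (y + h *: (x - y))) ('D_(x - y) f (y + t *: (x - y))).
  by move=> t01; apply: is_derive_line; have [] := fe _ (seg _ t01).
have [] := @MVT _ (fun h => f (y + h *: (x - y)))
  (fun t => 'D_(x - y) f (y + t *: (x - y))) 0 1 ltr01.
- by move=> t; rewrite in_itv/= => /andP[t0 t1]; apply: df; rewrite !ltW.
- apply: derivable_within_continuous => t; rewrite in_itv/= => t01.
  by have [] := df t t01.
move=> t; rewrite in_itv/= => /andP[t0 t1]; rewrite scale1r scale0r addr0.
rewrite [y + (x - y)]addrC subrK => ->; rewrite subr0 mulr1.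
have t01 : 0 <= t <= 1 by rewrite !ltW.
have [dft _ dfC] := fe _ (seg _ t01).
by rewrite deriveE.
Unshelve. all: by end_near. Qed.

End bounded_differential.

(** * Symmetry of second derivatives *)

Section second_derivatives.
Context {R : realType} {V : normedModType R}.

(** The mean value theorem is applied twice: to the increment of [f] along [h *: v], as a function
    of the displacement along [u], then to [fu] along [v]. Every point that occurs lies in the
    parallelogram spanned by [h *: u] and [h *: v]. *)
Lemma second_difference (f fu fuv : V -> R) (y u v : V) (r h : R) :
  0 < h -> h * (`|u| + `|v|) < r ->
  (forall z, ball y r z -> differentiable f z /\ 'D_u f z = fu z) ->
  (forall z, ball y r z -> differentiable fu z /\ 'D_v fu z = fuv z) ->
  exists2 z, ball y r z &
    f (y + h *: u + h *: v) - f (y + h *: u) - f (y + h *: v) + f y =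
    h ^+ 2 * fuv z.
Proof.
move=> h0 hr df dDf.
have inb (s t : R) : 0 <= s <= h -> 0 <= t <= h -> ball y r (y + t *: v + s *: u).
  move=> /andP[s0 sh] /andP[t0 th]; rewrite -ball_normE/=.
  have -> : y - (y + t *: v + s *: u) = - (t *: v + s *: u).
    by rewrite -addrA opprD addrA subrr add0r.
  rewrite normrN; apply: le_lt_trans hr; rewrite (le_trans (ler_normD _ _))//.
  by rewrite !normrZ !ger0_norm// mulrDr addrC lerD// ler_wpM2r.
pose phi s := f (y + h *: v + s *: u) - f (y + s *: u).
have h0h : 0 <= h <= h by rewrite lexx ltW.
have z0h : 0 <= (0 : R) <= h by rewrite lexx ltW.
have dphi (s : R) : 0 <= s <= h -> is_derive s 1 phi
    (fu (y + h *: v + s *: u) - fu (y + s *: u)).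
  move=> sh; have [d1 <-] := df _ (inb _ _ sh h0h).
  have := inb _ _ sh z0h; rewrite scale0r addr0 => /df[d2 <-].
  by apply: is_deriveB; exact: is_derive_line.
have [] := @MVT _ phi
  (fun s => fu (y + h *: v + s *: u) - fu (y + s *: u)) 0 h h0.
- by move=> t; rewrite in_itv/= => /andP[t0 t1]; apply: dphi; rewrite !ltW.
- apply: derivable_within_continuous => t; rewrite in_itv/= => t01.
  by have [] := dphi t t01.
move=> s; rewrite in_itv/= => /andP[s0 s1].
have sh : 0 <= s <= h by rewrite !ltW.
rewrite subr0 {1 2}/phi scale0r !addr0 => E1.
pose psi t := fu (y + s *: u + t *: v).
have inb' (t : R) : 0 <= t <= h -> ball y r (y + s *: u + t *: v).
  by move=> th; rewrite addrAC; exact: inb.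
have dpsi (t : R) : 0 <= t <= h -> is_derive t 1 psi
    (fuv (y + s *: u + t *: v)).
  by move=> th; have [d1 <-] := dDf _ (inb' _ th); exact: is_derive_line.
have [] := @MVT _ psi (fun t => fuv (y + s *: u + t *: v)) 0 h h0.
- by move=> t; rewrite in_itv/= => /andP[t0 t1]; apply: dpsi; rewrite !ltW.
- apply: derivable_within_continuous => t; rewrite in_itv/= => t01.
  by have [] := dpsi t t01.
move=> t; rewrite in_itv/= => /andP[t0 t1].
rewrite subr0 {1 2}/psi scale0r !addr0 => E2.
exists (y + s *: u + t *: v); first by apply: inb'; rewrite !ltW.
rewrite expr2 -mulrA (mulrC h (fuv _)) -E2 (addrAC y (s *: u)) mulrC -E1.
by rewrite (addrAC y (h *: u)) opprB addrA addrAC -!addrA; congr (_ + _); ring.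
Qed.

(** The second difference is symmetric in [u] and [v], so it equals both [h ^+ 2 * fuv z] and
    [h ^+ 2 * fvu z'] with [z] and [z'] close to [y]; continuity at [y] concludes. *)
Lemma Schwarz (f fu fv fuv fvu : V -> R) (y u v : V) :
  (\forall z \near y, differentiable f z /\ 'D_u f z = fu z) ->
  (\forall z \near y, differentiable f z /\ 'D_v f z = fv z) ->
  (\forall z \near y, differentiable fu z /\ 'D_v fu z = fuv z) ->
  (\forall z \near y, differentiable fv z /\ 'D_u fv z = fvu z) ->
  {for y, continuous fuv} -> {for y, continuous fvu} ->
  fuv y = fvu y.
Proof.
move=> du dv duv dvu cuv cvu; apply/eqP; rewrite -subr_eq0 -normr_le0.
apply/ler_addgt0Pr => e e0; rewrite add0r.
have e2 : 0 < e / 2 by rewrite divr_gt0.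
have [/= r1 r10 H1] := (nbhs_ballP _ _).1 (filterI du dv).
have [/= r2 r20 H2] := (nbhs_ballP _ _).1 (filterI duv dvu).
have /nbhs_ballP[r3 /= r30 H3] : \forall z \near y,
    `|fuv y - fuv z| < e / 2 /\ `|fvu y - fvu z| < e / 2.
  near=> z; split; near: z.
  - by move/cvgrPdist_lt : cuv; exact.
  - by move/cvgrPdist_lt : cvu; exact.
pose r := Num.min r1 (Num.min r2 r3).
have r0 : 0 < r by rewrite !lt_min r10 r20 r30.
have rr1 : r <= r1 by rewrite ge_min lexx.
have rr2 : r <= r2 by rewrite !ge_min lexx orbT.
have rr3 : r <= r3 by rewrite !ge_min lexx !orbT.
(* The [+ 1] covers the case where [u] and [v] are zero, and makes the inequality [hr] strict. *)
pose h := r / (`|u| + `|v| + 1).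
have uv0 : 0 < `|u| + `|v| + 1 by rewrite ltr_wpDl// addr_ge0.
have h0 : 0 < h by rewrite divr_gt0.
have hr : h * (`|u| + `|v|) < r.
  by rewrite /h mulrAC ltr_pdivrMr// ltr_pM2l// ltrDl.
have hr' : h * (`|v| + `|u|) < r by rewrite addrC.
have [z yz Ez] := @second_difference f fu fuv y u v r h h0 hr
  (fun z yz => (H1 z (le_ball rr1 yz)).1) (fun z yz => (H2 z (le_ball rr2 yz)).1).
have [z' yz' Ez'] := @second_difference f fv fvu y v u r h h0 hr'
  (fun z yz => (H1 z (le_ball rr1 yz)).2) (fun z yz => (H2 z (le_ball rr2 yz)).2).
have [Hz _] := H3 z (le_ball rr3 yz); have [_ Hz'] := H3 z' (le_ball rr3 yz').
have E : fuv z = fvu z'.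
  apply: (@mulfI _ (h ^+ 2)); first by rewrite expf_neq0// gt_eqF.
  rewrite -Ez -Ez' (addrAC y); congr (_ + _); ring.
rewrite E in Hz.
rewrite (splitr e) (_ : _ - _ = (fuv y - fvu z') - (fvu y - fvu z')); last by ring.
by rewrite (le_trans (ler_normB _ _))// lerD// ltW.
Unshelve. all: by end_near. Qed.

End second_derivatives.

(** * Functions of class C^m on open sets of R^n *)

Section Ck.
Context {R : realType} {n : nat}.

Lemma coord_linear_subproof k (b : 'I_k) :
  linear (fun v : 'rV[R]_k => v 0 b : R).
Proof. by move=> c u v; rewrite !mxE. Qed.

Lemma bounded_diff_coord (V : normedModType R) k (f : V -> 'rV[R]_k) x0 b :
  bounded_diff f x0 -> bounded_diff (fun x => f x 0 b) x0.
Proof.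
move=> bf; pose c : {linear 'rV[R]_k -> R} := HB.pack (fun v : 'rV[R]_k => v 0 b : R)
  (GRing.isLinear.Build _ _ _ _ _ (coord_linear_subproof b)).
apply: (bounded_diff_comp (g := c)) => //; apply: bounded_diff_lin; exact: coord_continuous.
Qed.

Lemma derive_coord (V : normedModType R) k (f : V -> 'rV[R]_k) x v b :
  derivable f x v -> 'D_v (fun x => f x 0 b) x = 'D_v f x 0 b.
Proof. by move=> df; rewrite derive_mx// mxE. Qed.

Lemma differentiable_row_coord (V : normedModType R) k (f : V -> 'rV[R]_k) x b :
  differentiable f x -> differentiable (fun x => f x 0 b) x.
Proof.
move=> df; apply: (differentiable_comp (g := fun v : 'rV[R]_k => v 0 b)) => //.
exact: differentiable_coord.
Qed.

Lemma Ck_onS (W : normedModType R) m A (f : 'rV[R]_n -> W) :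
  Ck_on m.+1 A f -> Ck_on m A f.
Proof.
elim: m f => [|m IH] f /=.
  by move=> [df _] y /df/differentiable_continuous.
by move=> [df H]; split=> // a; apply: IH; exact: H.
Qed.

(** The differential is a combination of the partial derivatives, and each of these stays within 1
    of its value at [y0] by continuity. *)
Lemma Ck_on_bounded_diff (W : normedModType R) A (f : 'rV[R]_n -> W) y0 :
  open A -> A y0 -> Ck_on 1 A f -> bounded_diff f y0.
Proof.
move=> oA Ay0 [df cf].
have nA : \forall y \near y0, A y by exact: open_nbhs_nbhs.
have cf0 : {for y0, continuous f} by exact/differentiable_continuous/df.
pose D a := 'D_(delta_mx 0 a) f.
exists (`|f y0| + 1 + \sum_a (`|D a y0| + 1)); near=> y.
have S0 : 0 <= \sum_a (`|D a y0| + 1) by apply: sumr_ge0 => a _; rewrite addr_ge0.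
have Ay : A y by near: y.
have dfy := df _ Ay.
have fy : `|f y| <= `|f y0| + 1.
  have : `|f y0 - f y| <= 1.
    by near: y; move/cvgrPdist_le : cf0; exact.
  by have := ler_normB (f y0) (f y0 - f y); rewrite opprB addrC subrK; lra.
have Dy a : `|D a y| <= `|D a y0| + 1.
  have : `|D a y0 - D a y| <= 1.
    move: a; near: y; apply: filter_forall => a.
    by move/cvgrPdist_le : (cf a _ Ay0); exact.
  by have := ler_normB (D a y0) (D a y0 - D a y); rewrite opprB addrC subrK; lra.
split => //; first by rewrite (le_trans fy)// lerDl.
move=> v; rewrite (diff_rV _ dfy) mulrDl (le_trans (ler_norm_sum _ _ _))//.
apply: ler_wpDl; first by rewrite mulr_ge0// addr_ge0.
rewrite mulr_suml ler_sum// => a _; rewrite normrZ mulrC.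
by apply: ler_pM => //; [exact: Dy|exact: ler_coord_norm].
Unshelve. all: by end_near. Qed.

Lemma Ck_on_Schwarz k A (f : 'rV[R]_n -> 'rV[R]_k) y a b :
  open A -> A y -> Ck_on 2 A f ->
  'D_(delta_mx 0 a) ('D_(delta_mx 0 b) f) y =
  'D_(delta_mx 0 b) ('D_(delta_mx 0 a) f) y.
Proof.
move=> oA Ay [df /= Df]; apply/rowP => c.
have nA : \forall y \near y, A y by exact: open_nbhs_nbhs.
have H1 d : \forall z \near y, differentiable (fun z => f z 0 c) z /\
    'D_(delta_mx 0 d) (fun z => f z 0 c) z = 'D_(delta_mx 0 d) f z 0 c.
  apply: filterS nA => z Az; have dfz := df z Az.
  by split; [exact: differentiable_row_coord|rewrite derive_coord//; exact: diff_derivable].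
have H2 d d' : \forall z \near y,
    differentiable (fun z => 'D_(delta_mx 0 d) f z 0 c) z /\
    'D_(delta_mx 0 d') (fun z => 'D_(delta_mx 0 d) f z 0 c) z =
    'D_(delta_mx 0 d') ('D_(delta_mx 0 d) f) z 0 c.
  apply: filterS nA => z Az; have dfz := (Df d).1 z Az.
  by split; [exact: differentiable_row_coord|rewrite derive_coord//; exact: diff_derivable].
have cf d d' : {for y, continuous (fun z => 'D_(delta_mx 0 d') ('D_(delta_mx 0 d) f) z 0 c)}.
  have := (Df d).2 d' y Ay => H.
  apply: (continuous_comp (g := fun v : 'rV[R]_k => v 0 c)) => //.
  exact: coord_continuous.
exact: (Schwarz (H1 b) (H1 a) (H2 b a) (H2 a b) (cf b a) (cf a b)).
Qed.

End Ck.

(** * Ordinary differential equations *)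

Section picard.
Context {R : realType}.

(** The mean value theorem holds componentwise, which suffices for the sup norm. Continuity on the
    whole line covers the endpoints |t| = T, where no derivative is assumed. *)
Lemma mean_value_bound n (x dx : R -> 'rV[R]_n) (T M t : R) :
  continuous x -> (forall s : R, `|s| < T -> is_derive s 1 x (dx s)) ->
  (forall s, `|s| < T -> `|dx s| <= M) -> `|t| <= T ->
  `|x t - x 0| <= M * `|t|.
Proof.
move=> cx Dx dxM tT.
have [->|t0] := eqVneq t 0; first by rewrite subrr !normr0 mulr0.
have T0 : 0 < T by rewrite (lt_le_trans _ tT)// normr_gt0.
have M0 : 0 <= M by rewrite (le_trans _ (dxM 0 _)) ?normr0.
apply: rV_norm_le => [|a]; first by rewrite mulr_ge0.
have cxa : continuous (fun s => x s 0 a).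
  move=> s; apply: (continuous_comp (g := fun v : 'rV[R]_n => v 0 a)); first exact: cx.
  exact: coord_continuous.
have Dxa (s : R) : `|s| < T -> is_derive s 1 (fun s => x s 0 a) (dx s 0 a).
  by move=> /Dx; exact: is_derive_coord.
have dM (s : R) : `|s| < T -> `|dx s 0 a| <= M.
  by move=> sT; rewrite (le_trans (ler_coord_norm _ _))// dxM.
rewrite !mxE; have [tp|tn] := ltP 0 t.
  have [] := @MVT _ (fun s => x s 0 a) (fun s => dx s 0 a) 0 t tp.
  - move=> s; rewrite in_itv/= => /andP[s0 st]; apply: Dxa.
    by rewrite ger0_norm ?ltW// (lt_le_trans st)// -(ger0_norm (ltW tp)).
  - exact: continuous_subspaceT.
  move=> s; rewrite in_itv/= subr0 => /andP[s0 st] ->.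
  rewrite normrM ler_wpM2r// dM// ger0_norm ?ltW// (lt_le_trans st)//.
  by rewrite -(ger0_norm (ltW tp)).
have {}tn : t < 0 by rewrite lt_neqAle t0.
have [] := @MVT _ (fun s => x s 0 a) (fun s => dx s 0 a) t 0 tn.
- move=> s; rewrite in_itv/= => /andP[ts s0]; apply: Dxa.
  by rewrite ltr0_norm// (lt_le_trans _ tT)// ltr0_norm// ltrN2.
- exact: continuous_subspaceT.
move=> s; rewrite in_itv/= sub0r => /andP[ts s0].
rewrite distrC => ->; rewrite normrM normrN ler_wpM2r// dM//.
by rewrite ltr0_norm// (lt_le_trans _ tT)// ltr0_norm// ltrN2.
Qed.

Lemma primitive (g : R -> R) (T : R) : continuous g ->
  exists H : R -> R, forall t : R, `|t| <= T -> is_derive t 1 H (g t).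
Proof.
move=> cg.
(* Integrating from -(T + 1) makes every time of [-T, T] interior, so that the derivative is
   two-sided at the endpoints too. *)
exists (fun t => \int[lebesgue_measure]_(s in `[(- (T + 1))%R, t]) g s)%R => t tT.
have [t1 t2] : - (T + 1) < t /\ t < T + 1.
  by move: tT; rewrite ler_norml => /andP[]; split; lra.
have [] := @continuous_FTC1_closed R g (- (T + 1)) t (T + 1) t2 _ t1 (cg t).
  apply: continuous_compact_integrable; first exact: segment_compact.
  exact: continuous_subspaceT.
by move=> d <-; rewrite derive1E; exact: derivableP.
Qed.

Lemma primitive_rV n (g : R -> 'rV[R]_n) (T : R) : continuous g ->
  exists H : R -> 'rV[R]_n, forall t : R, `|t| <= T -> is_derive t 1 H (g t).
Proof.
move=> cg; have H a : exists h : R -> R, forall t : R, `|t| <= T ->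
    is_derive t 1 h (g t 0 a).
  apply: primitive => s.
  apply: (continuous_comp (g := fun v : 'rV[R]_n => v 0 a)); first exact: cg.
  exact: coord_continuous.
have [h Hh] := choice H.
exists (fun t => \row_a h a t) => t tT; apply: is_derive_rV => a.
rewrite (_ : (fun s => _) = h a); last by apply/funext => s; rewrite mxE.
exact: Hh.
Qed.

(* Precomposing with [clamp] makes the Picard iterates continuous on the whole
   line, so that they live in one space of functions. *)
Definition clamp (T t : R) : R := Num.max (- T) (Num.min T t).

Lemma clamp_id (T t : R) : `|t| <= T -> clamp T t = t.
Proof. by rewrite ler_norml => /andP[? ?]; rewrite /clamp min_r// max_r. Qed.

Lemma clamp_le (T t : R) : 0 <= T -> `|clamp T t| <= T.
Proof.
move=> T0; rewrite /clamp ler_norml le_max lexx/= ge_max.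
by rewrite ge_min lexx/= andbT; lra.
Qed.

(** [clamp T] is 1-Lipschitz, which is checked case by case. *)
Lemma clamp_continuous (T : R) : 0 <= T -> continuous (clamp T).
Proof.
move=> T0 t; apply/cvgrPdist_le => e e0; near=> s.
have : `|t - s| <= e by near: s; exact: cvgr_dist_le.
apply: le_trans; rewrite /clamp.
rewrite /Order.max /Order.min.
by repeat case: ifPn; rewrite -?leNgt => *;
  rewrite ler_norml; apply/andP; split;
  have := ler_norm (t - s); have := ler_norm (s - t); rewrite (distrC s); lra.
Unshelve. all: by end_near. Qed.

Lemma geometric_cvg (u : nat -> R) (D : R) :
  (forall j, `|u j.+1 - u j| <= D / 2 ^+ j) ->
  exists l, forall j, `|l - u j| <= 2 * D / 2 ^+ j.
Proof.
move=> Hu; have D0 : 0 <= D.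
  by have := Hu 0%N; rewrite expr0 divr1; exact: le_trans.
have p2 j : 0 < (2 : R) ^+ j by rewrite exprn_gt0.
(* Subtracting the remaining tail of the geometric series makes the induction on [m] telescope. *)
have Hm j m : `|u (j + m)%N - u j| <= 2 * D / 2 ^+ j - 2 * D / 2 ^+ (j + m).
  elim: m => [|m IH]; first by rewrite addn0 !subrr normr0.
  rewrite addnS; apply: (@le_trans _ _ (`|u (j + m).+1 - u (j + m)%N| +
      `|u (j + m)%N - u j|)).
    by rewrite -(subrKA (u (j + m)%N)) ler_normD.
  have := Hu (j + m)%N; move: IH.
  have -> : 2 * D / 2 ^+ (j + m).+1 = D / 2 ^+ (j + m).
    by rewrite exprS invfM mulrACA divff ?mul1r.
  have -> : 2 * D / 2 ^+ (j + m) = D / 2 ^+ (j + m) + D / 2 ^+ (j + m).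
    by rewrite -mulrA mulr_natl mulr2n.
  lra.
have Hle j m : (j <= m)%N -> `|u m - u j| <= 2 * D / 2 ^+ j.
  move=> /subnKC <-; apply: (le_trans (Hm _ _)).
  by rewrite gerBl divr_ge0// ?mulr_ge0// ltW.
have cu : cvgn u.
  apply/cauchy_cvgP/cauchy_exP => e e0.
  have [j Hj] : exists j, 2 * D / 2 ^+ j < e.
    have := @cvg_geometric R (2 * D) (2^-1); rewrite ger0_norm ?invr_ge0// => /(_ _).
    rewrite invf_lt1// => /(_ (ltr1n _ _)) /cvgrPdist_lt /(_ e e0) [j _ /(_ j)] /=.
    move=> /(_ (leqnn _)); rewrite sub0r normrN ger0_norm.
      by exists j; rewrite -exprVn.
    by rewrite mulr_ge0 ?mulr_ge0// exprn_ge0// invr_ge0.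
  exists (u j), j => // m /= jm; rewrite -ball_normE/= distrC.
  exact: le_lt_trans (Hle _ _ jm) Hj.
exists (limn u) => j.
apply/ler_addgt0Pr => e e0.
have [N _ HN] : \forall m \near \oo, `|limn u - u m| < e.
  by move/cvgrPdist_lt : cu; exact.
have := HN _ (leq_maxr j N); have := Hle _ _ (leq_maxl j N).
by have := ler_normD (limn u - u (maxn j N)) (u (maxn j N) - u j); rewrite subrKA; lra.
Qed.

Lemma near_dist_le (V : normedModType R) (x : V) (e : R) :
  0 < e -> \forall y \near x, `|x - y| <= e.
Proof.
move=> e0; have : \forall y \near x, ball x e y by exact: nbhsx_ballx.
by apply: filterS => y; rewrite -ball_normE/= => /ltW.
Qed.

Lemma lipschitz_ball_continuous (V W : normedModType R) (f : V -> W) x0 r L :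
  0 <= L ->
  (forall x y, ball x0 r x -> ball x0 r y -> `|f x - f y| <= L * `|x - y|) ->
  forall x, ball x0 r x -> {for x, continuous f}.
Proof.
move=> L0 fL x xr; apply/cvgrPdist_le => e e0.
have L1 : 0 < L + 1 by lra.
have : \forall y \near x, ball x0 r y.
  by apply: open_nbhs_nbhs; split => //; exact: ball_open.
have : \forall y \near x, `|x - y| <= e / (L + 1).
  by apply: near_dist_le; rewrite divr_gt0.
apply: filterS2 => y xy yr; apply: (le_trans (fL _ _ xr yr)).
apply: (@le_trans _ _ ((L + 1) * `|x - y|)); first by rewrite ler_wpM2r//; lra.
by rewrite mulrC -ler_pdivlMr.
Qed.

(** Picard iteration on curves that stay within [r / 2] of [x0], for a time [T] so short that each
    step halves distances. *)
Lemma picard n (f : 'rV[R]_n -> 'rV[R]_n) (x0 : 'rV[R]_n) (r L : R) :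
  0 < r -> 0 <= L ->
  (forall x y, ball x0 r x -> ball x0 r y -> `|f x - f y| <= L * `|x - y|) ->
  exists2 T : R, 0 < T & exists2 x : R -> 'rV[R]_n, x 0 = x0 &
    forall t : R, `|t| < T -> ball x0 r (x t) /\ is_derive t 1 x (f (x t)).
Proof.
move=> r0 L0 fL; pose B := `|f x0| + L * r.
have B0 : 0 <= B by rewrite addr_ge0// mulr_ge0// ltW.
(* As speeds are at most [B], the first bound keeps the iterates within [r / 2] of [x0]; the second
   makes the contraction factor [L * T] at most 1 / 2. The [+ 1] avoids zero denominators. *)
pose T := Num.min (r / 2 / (B + 1)) (1 / 2 / (L + 1)).
have B1 : 0 < B + 1 by lra.
have L1 : 0 < L + 1 by lra.
have T0 : 0 < T by rewrite lt_min !divr_gt0.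
have TB : B * T <= r / 2.
  apply: (@le_trans _ _ ((B + 1) * T)); first by rewrite ler_wpM2r ?ltW//; lra.
  by rewrite mulrC -ler_pdivlMr// ge_min lexx.
have TL : L * T <= 1 / 2.
  apply: (@le_trans _ _ ((L + 1) * T)); first by rewrite ler_wpM2r ?ltW//; lra.
  by rewrite mulrC -ler_pdivlMr// ge_min lexx orbT.
have fB (x : 'rV[R]_n) : ball x0 r x -> `|f x| <= B.
  move=> xr; have := fL _ _ xr (ballxx _ r0).
  have : `|f x| <= `|f x - f x0| + `|f x0| by rewrite -{1}(subrK (f x0) (f x)) ler_normD.
  have : L * `|x - x0| <= L * r.
    by rewrite ler_wpM2l// distrC; move: xr; rewrite -ball_normE/= => /ltW.
  by rewrite /B; lra.
have fc (x : 'rV[R]_n) : ball x0 r x -> {for x, continuous f}.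
  exact: (lipschitz_ball_continuous L0 fL).
pose X : set (R -> 'rV[R]_n) := [set x : R -> 'rV[R]_n | continuous x /\
  forall t, `|x0 - x t| <= r / 2].
have Xr (x : R -> 'rV[R]_n) t : X x -> ball x0 r (x t).
  move=> [_ /(_ t)]; rewrite -ball_normE/= => /le_lt_trans; apply; lra.
(* [y] is the Picard iterate of [x], frozen outside [-T, T]. *)
pose step (x y : R -> 'rV[R]_n) := [/\ X y, y 0 = x0, (forall t, y t = y (clamp T t))
  & forall t : R, `|t| < T -> is_derive t 1 y (f (x t))].
(* The premise [X x] sits under the existential so that [choice] yields a total function. *)
have ex_step x : exists y, X x -> step x y.
  have [Xx|nX] := pselect (X x); last by exists x.
  have [H HH] : exists H : R -> 'rV[R]_n, forall t : R, `|t| <= T ->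
      is_derive t 1 H (f (x t)).
    apply: primitive_rV => t; apply: continuous_comp; first exact: Xx.1.
    exact/fc/Xr.
  pose y (t : R) : 'rV[R]_n := x0 + H (clamp T t) - H 0.
  have y0 : y 0 = x0 by rewrite /y clamp_id ?normr0 ?ltW// addrK.
  have yc t : y t = y (clamp T t).
    by rewrite /y (clamp_id (clamp_le t (ltW T0))).
  have dy (t : R) : `|t| < T -> is_derive t 1 y (f (x t)).
    move=> tT; apply: (@near_eq_is_derive _ _ _ (fun t => x0 + H t - H 0)).
      have : \forall s \near t, `|s| < T by exact: cvgr_norm_lt (@cvg_id _ (nbhs t)) _ tT.
      by apply: filterS => s sT; rewrite /y clamp_id// ltW.
    apply: (@is_derive_eq _ _ _ _ _ _ _ (0 + f (x t) - 0)); last by rewrite add0r subr0.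
    apply: is_deriveB; apply: is_deriveD; exact/HH/ltW.
  have cy : continuous y.
    have cH : continuous (H \o clamp T).
      move=> t; apply: continuous_comp; first by apply: clamp_continuous; exact: ltW.
      apply/differentiable_continuous/derivable1_diffP.
      by have [] := HH _ (clamp_le t (ltW T0)).
    move=> t; apply: cvgB; last exact: cvg_cst.
    by apply: cvgD; [exact: cvg_cst|exact: cH].
  exists y => _; split => //; split => // t; rewrite distrC yc -y0.
  apply: (le_trans (mean_value_bound cy dy (M := B) _ _)).
  - by move=> s sT; exact/fB/Xr.
  - exact/clamp_le/ltW.
  - by apply: le_trans TB; rewrite ler_wpM2l// clamp_le// ltW.
have contr (x y x' y' : R -> 'rV[R]_n) D : X x -> X y -> step x x' -> step y y' ->
    (forall t, `|x t - y t| <= D) -> forall t, `|x' t - y' t| <= D / 2.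
  move=> Xx Xy [[cx' _] x'0 x'c dx'] [[cy' _] y'0 y'c dy'] xyD t.
  rewrite x'c y'c; set s := clamp T t.
  have D0 : 0 <= D by exact: le_trans (xyD 0).
  have -> : x' s - y' s = (x' \- y') s - (x' \- y') 0 by rewrite /= x'0 y'0 subrr subr0.
  apply: (le_trans (@mean_value_bound _ (x' \- y') (fun t => f (x t) - f (y t))
    T (L * D) s _ _ _ _)).
  - by move=> u; apply: cvgB; [exact: cx'|exact: cy'].
  - by move=> u uT; apply: is_deriveB; [exact: dx'|exact: dy'].
  - move=> u _; apply: (le_trans (fL _ _ (Xr _ _ Xx) (Xr _ _ Xy))).
    by rewrite ler_wpM2l.
  - exact/clamp_le/ltW.
  have : L * D * `|s| <= L * D * T by rewrite ler_wpM2l ?mulr_ge0// clamp_le// ltW.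
  have : D * (L * T) <= D * (1 / 2) by rewrite ler_wpM2l.
  lra.
have [S HS] := choice ex_step.
pose x_ j := iter j S (cst x0).
have Xx_ j : X (x_ j).
  elim: j => [|j IH]; last by have [] := HS _ IH.
  split=> t; first exact: cvg_cst.
  by rewrite subrr normr0; lra.
have stepx j : step (x_ j) (x_ j.+1) by exact/HS/Xx_.
have dist_x j t : `|x_ j.+1 t - x_ j t| <= r / 2 ^+ j.
  elim: j t => [|j IH] t.
    have [[_ X1] _ _ _] := stepx 0%N.
    by rewrite distrC expr0 divr1; apply: (le_trans (X1 t)); lra.
  have := contr _ _ _ _ _ (Xx_ j.+1) (Xx_ j) (stepx j.+1) (stepx j) IH t.
  by rewrite exprS invfM mulrA mulrAC.
(* The limit is taken at each time and in each component separately; the bound is uniform in time,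
   whence the continuity of [x]. *)
have [x Hx] : exists x : R -> 'rV[R]_n, forall t j, `|x t - x_ j t| <= 2 * r / 2 ^+ j.
  have [] := @choice _ _ (fun t (l : 'rV[R]_n) => forall j, `|l - x_ j t| <= 2 * r / 2 ^+ j).
    move=> t; have [] := @choice _ _ (fun a (l : R) => forall j,
        `|l - x_ j t 0 a| <= 2 * r / 2 ^+ j).
      move=> a; apply: geometric_cvg => j.
      by apply: le_trans (dist_x j t); have := ler_coord_norm (x_ j.+1 t - x_ j t) a; rewrite !mxE.
    move=> l Hl; exists (\row_a l a) => j; apply: rV_norm_le.
      by rewrite divr_ge0 ?exprn_ge0// mulr_ge0// ltW.
    by move=> a; rewrite !mxE.
  by move=> x Hx; exists x.
have geo (e : R) : 0 < e -> exists j, 4 * r / 2 ^+ j < e.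
  move=> e0; have := @cvg_geometric R (4 * r) (2^-1); rewrite ger0_norm ?invr_ge0// => /(_ _).
  rewrite invf_lt1// => /(_ (ltr1n _ _)) /cvgrPdist_lt /(_ e e0) [j _ /(_ j)] /=.
  move=> /(_ (leqnn _)); rewrite sub0r normrN ger0_norm.
    by exists j; rewrite -exprVn.
  by rewrite mulr_ge0 ?mulr_ge0 ?(ltW r0)// exprn_ge0// invr_ge0.
have cx : continuous x.
  move=> t; apply/cvgrPdist_le => e e0.
  have [j Hj] := geo (e / 2) ltac:(lra).
  have := (Xx_ j).1 t => /cvgrPdist_le /(_ (e / 2)) /(_ ltac:(lra)).
  apply: filterS => s Hs.
  rewrite (_ : x t - x s = (x t - x_ j t) + (x_ j t - x_ j s) - (x s - x_ j s)); last first.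
    by rewrite subrKA opprB subrKA.
  have := Hx t j; have := Hx s j.
  have := ler_normB (x t - x_ j t + (x_ j t - x_ j s)) (x s - x_ j s).
  have := ler_normD (x t - x_ j t) (x_ j t - x_ j s).
  lra.
have Xx : X x.
  split=> // t; apply/ler_addgt0Pr => e e0; have [j Hj] := geo e e0.
  have := (Xx_ j).2 t; have := Hx t j.
  have := ler_normB (x0 - x_ j t) (x t - x_ j t); rewrite opprB addrA subrK.
  have : 0 <= r / 2 ^+ j by rewrite divr_ge0 ?exprn_ge0// ltW.
  lra.
(* One more step from the limit [x] gives [y], and the contraction forces [y = x]. So [x] solves the
   equation, without passing to the limit in derivatives or integrals. *)
have [y stepy] := ex_step x; have {}stepy := stepy Xx.
have xy t : x t = y t.
  apply/eqP; rewrite -subr_eq0 -normr_le0; apply/ler_addgt0Pr => e e0; rewrite add0r.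
  have [j Hj] := geo e e0.
  have := contr _ _ _ _ _ Xx (Xx_ j) stepy (stepx j) (fun t => Hx t j) t.
  have := Hx t j.+1; rewrite exprS invfM.
  have := ler_normB (x t - x_ j.+1 t) (y t - x_ j.+1 t); rewrite opprB addrA subrK.
  lra.
have {}xy : x = y by exact/funext.
have [_ y0 _ dy] := stepy; rewrite -xy in y0 dy.
by exists T => //; exists x => // t tT; split; [exact: Xr|exact: dy].
Qed.

End picard.

(** * Derivatives of sums and products, along lines, and at a minimum *)

Section derive_helpers.
Context {R : realType}.

Lemma is_derive_sumf (V W : normedModType R) n (h : 'I_n -> V -> W) (x v : V)
    (dh : 'I_n -> W) :
  (forall i, is_derive x v (h i) (dh i)) ->
  is_derive x v (fun s => \sum_i h i s) (\sum_i dh i).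
Proof.
move=> H; rewrite (_ : (fun s => _) = \sum_i h i); first exact: is_derive_sum.
by apply/funext => s; rewrite fct_sumE.
Qed.

Lemma is_derive_mulf (V : normedModType R) (f g : V -> R) (x v : V) (df dg : R) :
  is_derive x v f df -> is_derive x v g dg ->
  is_derive x v (fun s => f s * g s) (df * g x + f x * dg).
Proof.
move=> Hf Hg; apply: (@is_derive_eq _ _ _ _ _ _ _ (f x *: dg + g x *: df)).
by rewrite addrC [g x *: df]mulrC.
Qed.

Lemma is_derive_mulr (V : normedModType R) (f : V -> R) (x v : V) (c df : R) :
  is_derive x v f df -> is_derive x v (fun s => f s * c) (df * c).
Proof.
move=> Hf; have := is_derive_mulf Hf (is_derive_cst c x v).
by rewrite mulr0 addr0.
Qed.

Lemma derive_along (V W : normedModType R) (f : V -> W) (y v : V) (d : W) :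
  is_derive (0 : R) 1 (fun h => f (y + h *: v)) d -> 'D_v f y = d.
Proof.
move=> [_ <-]; rewrite /derive; set g1 := (fun h => _); set g2 := (fun h => _).
suff -> : g1 = g2 by [].
apply/funext => h; rewrite /g1 /g2/=.
by rewrite addr0 scale0r addr0 [h%:A]mulr1 [_ + y]addrC.
Qed.

Lemma derive_at_min (V : normedModType R) (f : V -> R) y v :
  (\forall z \near y, differentiable f z) -> (forall z, f y <= f z) ->
  'D_v f y = 0.
Proof.
move=> df fmin; apply: derive_along.
have : \forall h \near (0 : R), differentiable f (y + h *: v).
  have [/derivable1_diffP/differentiable_continuous + _] := is_derive_affine y v (0 : R).
  rewrite /prop_for/continuous_at scale0r addr0 => cl; exact: (cl _ df).
move=> /nbhs_ballP[d /= d0 Hd].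
have d0' : - d < d by rewrite gtrN.
apply: (@derive1_at_min R _ (- d) d 0 (ltW d0')).
- move=> h; rewrite in_itv/= => /andP[h1 h2].
  have dfh : differentiable f (y + h *: v).
    by apply: Hd; rewrite /ball/= sub0r normrN ltr_norml h1.
  by have [] := is_derive_line dfh.
- by rewrite in_itv/= oppr_lt0 d0.
- by move=> h _; rewrite scale0r addr0.
Qed.

End derive_helpers.

(** * Lagrangian mechanics in R^n *)

Section lagrangian.
Context {R : realType} {n : nat}.
(* [G] is the Gram matrix of the metric; [kinetic] is the squared norm of the
   velocity, twice the kinetic energy. *)
Variables (G : 'I_n -> 'I_n -> 'rV[R]_n -> R) (U : 'rV[R]_n -> R).
Hypothesis Gsym : forall a b y, G a b y = G b a y.

Definition momentum y (w : 'rV[R]_n) a := \sum_b G a b y * w 0 b.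

Definition kinetic y (w : 'rV[R]_n) := \sum_a momentum y w a * w 0 a.

Definition lagrangian y w := kinetic y w / 2 - U y.

(** This is dL/dy_a, and [momentum] is dL/dw_a: the Euler-Lagrange equations say that the momentum
    has derivative [force]. *)
Definition force y (w : 'rV[R]_n) a :=
  (\sum_b \sum_c 'D_(delta_mx 0 a) (G b c) y * w 0 c * w 0 b) / 2 -
  'D_(delta_mx 0 a) U y.

Lemma is_derive_momentum (q w : R -> 'rV[R]_n) (t : R) dq dw a :
  (forall b, differentiable (G a b) (q t)) ->
  is_derive t 1 q dq -> is_derive t 1 w dw ->
  is_derive t 1 (fun s => momentum (q s) (w s) a)
    (\sum_b 'd (G a b) (q t) dq * w t 0 b + momentum (q t) dw a).
Proof.
move=> dG Dq Dw; rewrite /momentum -big_split/=; apply: is_derive_sumf => b.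
apply: is_derive_mulf; last exact: is_derive_coord.
exact: is_derive_diff_comp.
Qed.

(** Symmetry of [G] makes the two terms in [dw] equal, and the factor 1 / 2 of the kinetic energy
    absorbs the doubling. As [w] is an arbitrary curve, the formula serves for partial derivatives
    in position, for changes of charts and for the conservation of energy. *)
Lemma is_derive_lagrangian (q w : R -> 'rV[R]_n) (t : R) dq dw :
  (forall a b, differentiable (G a b) (q t)) -> differentiable U (q t) ->
  is_derive t 1 q dq -> is_derive t 1 w dw ->
  is_derive t 1 (fun s => lagrangian (q s) (w s))
    (\sum_a (force (q t) (w t) a * dq 0 a + momentum (q t) (w t) a * dw 0 a)).
Proof.
move=> dG dU Dq Dw; rewrite /lagrangian.
have D1 a := is_derive_mulf (is_derive_momentum (dG a) Dq Dw) (is_derive_coord a Dw).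
have D2 := is_derive_mulr 2^-1 (is_derive_sumf D1).
have D3 := is_derive_diff_comp dU Dq.
apply: is_derive_eq (is_deriveB D2 D3) _.
rewrite (diff_rV _ dU) big_split/=.
under eq_bigr do rewrite mulrDl.
rewrite !big_split/=.
have -> : \sum_a momentum (q t) dw a * w t 0 a = \sum_a momentum (q t) (w t) a * dw 0 a.
  under eq_bigr do rewrite /momentum mulr_suml.
  under [RHS]eq_bigr do rewrite /momentum mulr_suml.
  rewrite exchange_big/=; apply: eq_bigr => a _; apply: eq_bigr => b _.
  by rewrite Gsym mulrAC.
set M := \sum_a momentum _ _ a * dw 0 a.
rewrite -(addrA _ M) -(mulr2n M) -(mulr_natr M) mulrDl mulfK ?pnatr_eq0//.
rewrite addrAC; congr (_ + M).
under [RHS]eq_bigr do rewrite /force mulrBl.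
rewrite sumrB; congr (_ - _); last by apply: eq_bigr => a _; rewrite mulrC.
under [RHS]eq_bigr do rewrite mulrAC.
rewrite -mulr_suml; congr (_ / 2).
under eq_bigr do rewrite mulr_suml.
under [RHS]eq_bigr do rewrite mulr_suml.
rewrite [RHS]exchange_big/=; apply: eq_bigr => a _.
under [RHS]eq_bigr do rewrite mulr_suml.
rewrite [RHS]exchange_big/=; apply: eq_bigr => b _.
rewrite diff_rV// !mulr_suml; apply: eq_bigr => c _.
by rewrite [_ *: _]mulrC -!mulrA; congr (_ * _); rewrite mulrC -mulrA.
Qed.

Lemma derive_lagrangian_velocity y w a :
  'D_(delta_mx 0 a) (lagrangian y) w = momentum y w a.
Proof.
apply: derive_along; rewrite /lagrangian.
have Dw := is_derive_affine w (delta_mx 0 a) (0 : R).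
have De b : momentum y (delta_mx 0 a) b = G b a y.
  rewrite /momentum (bigD1 a)//= mxE !eqxx mulr1 big1 ?addr0// => c ca.
  by rewrite mxE (negbTE ca) andbF mulr0.
have D0 b : is_derive (0 : R) 1 (fun h : R => momentum y (w + h *: delta_mx 0 a) b) (G b a y).
  apply: (@is_derive_eq _ _ _ _ _ _ _ (momentum y (delta_mx 0 a) b)) => //.
  apply: is_derive_sumf => c.
  have := is_derive_mulf (is_derive_cst (G b c y) (0 : R) 1) (is_derive_coord c Dw).
  by rewrite mul0r add0r.
have D1 b := is_derive_mulf (D0 b) (is_derive_coord b Dw).
have D2 := is_derive_mulr 2^-1 (is_derive_sumf D1).
apply: is_derive_eq (is_deriveB D2 (is_derive_cst (U y) (0 : R) 1)) _.
rewrite subr0 !scale0r !addr0 big_split/=.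
rewrite [X in (_ + X) / 2](bigD1 a)//= mxE !eqxx mulr1 [X in _ + (_ + X)]big1 ?addr0; last first.
  by move=> b ba; rewrite mxE (negbTE ba) andbF mulr0.
rewrite (_ : \sum_i _ = momentum y w a); last by apply: eq_bigr => b _; rewrite Gsym.
by rewrite mulrDl -splitr.
Qed.

Lemma derive_lagrangian_position y w a :
  (forall a b, differentiable (G a b) y) -> differentiable U y ->
  'D_(delta_mx 0 a) (lagrangian^~ w) y = force y w a.
Proof.
move=> dG dU; apply: derive_along.
have := @is_derive_lagrangian (fun h => y + h *: delta_mx 0 a) (cst w) 0 (delta_mx 0 a) 0.
rewrite scale0r addr0 => /(_ dG dU (is_derive_affine _ _ _) (is_derive_cst _ _ _)).
move=> H; apply: is_derive_eq H _.
rewrite (bigD1 a)//= !mxE !eqxx mulr1 mulr0 addr0 big1 ?addr0// => b ba.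
by rewrite !mxE (negbTE ba) !mulr0 addr0.
Qed.

End lagrangian.

(** * Invariance of the Euler-Lagrange equations under changes of charts *)

Section change_of_chart.
Context {R : realType} {n : nat}.
Variables (G : 'I_n -> 'I_n -> 'rV[R]_n -> R) (U : 'rV[R]_n -> R).
Hypothesis Gsym : forall a b y, G a b y = G b a y.

(** With p the momentum and f the force in the chart reached by [sigma], dL/dw_b is the sum over a
    of p_a d_b sigma_a. Its time derivative is the sum of f_a d_b sigma_a and p_a d(d_b
    sigma_a)(q'), while dL/dy_b is the sum of f_a d_b sigma_a and p_a d_b(d sigma_a(q')). They agree
    by the symmetry of second derivatives. *)
Lemma Euler_Lagrange_change_chart (B : set 'rV[R]_n) (sigma : 'rV[R]_n -> 'rV[R]_n)
    (L : 'rV[R]_n -> 'rV[R]_n -> R) (q : R -> 'rV[R]_n) (t : R) :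
  open B -> Ck_on 2 B sigma ->
  (forall y w, B y -> L y w = lagrangian G U (sigma y) ('d sigma y w)) ->
  (forall y, B y -> (forall a b, differentiable (G a b) (sigma y)) /\
                    differentiable U (sigma y)) ->
  (\forall s \near t, B (q s)) -> derivable q t 1 ->
  (forall a, is_derive t 1
     (fun s => momentum G (sigma (q s)) ('d sigma (q s) (q^`()%classic s)) a)
     (force G U (sigma (q t)) ('d sigma (q t) (q^`()%classic t)) a)) ->
  forall b, is_derive t 1
    (fun s => 'D_(delta_mx 0 b) (L (q s)) (q^`()%classic s))
    ('D_(delta_mx 0 b) (fun y => L y (q^`()%classic t)) (q t)).
Proof.
move=> oB C2s LE dGU nB dq EL b; set e := delta_mx 0 b.
have [ds Ds] := C2s; have Bt : B (q t) by exact: nbhs_singleton nB.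
have DL y u : B y -> 'D_e (L y) u =
    \sum_a momentum G (sigma y) ('d sigma y u) a * 'D_e sigma y 0 a.
  move=> By; apply: derive_along.
  rewrite (_ : (fun h => _) = fun h : R => lagrangian G U (cst (sigma y) h)
      ('d sigma y u + h *: 'd sigma y e)); last first.
    by apply/funext => h; rewrite LE// linearD linearZ.
  have [dG dU] := dGU _ By.
  apply: is_derive_eq (is_derive_lagrangian Gsym (q := cst (sigma y)) dG dU
    (is_derive_cst _ _ _) (is_derive_affine ('d sigma y u) ('d sigma y e) (0 : R))) _.
  apply: eq_bigr => a _; rewrite mxE mulr0 add0r scale0r addr0.
  by rewrite deriveE//; exact: ds.
have Dq : is_derive t 1 q (q^`()%classic t) by rewrite derive1E; exact: derivableP.
apply: (@near_eq_is_derive _ _ _ (fun s =>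
  \sum_a momentum G (sigma (q s)) ('d sigma (q s) (q^`()%classic s)) a * 'D_e sigma (q s) 0 a)).
  by apply: filterS nB => s Bs; rewrite DL.
have dDs := (Ds b).1 _ Bt.
have D1 a := is_derive_mulf (EL a) (is_derive_coord a (is_derive_diff_comp dDs Dq)).
apply: is_derive_eq (is_derive_sumf D1) _.
set u := q^`() t; apply/esym.
apply: derive_along.
(* The image of [u] under the differential of [sigma] at [q t + h *: e], expanded in partial
   derivatives so that it can be differentiated in [h]. *)
pose w (h : R) := \sum_c u 0 c *: 'D_(delta_mx 0 c) sigma (q t + h *: e).
have line0 : q t + (0 : R) *: e = q t by rewrite scale0r addr0.
apply: (@near_eq_is_derive _ _ _ (fun h : R =>
  lagrangian G U (sigma (q t + h *: e)) (w h))).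
  have : \forall h \near (0 : R), B (q t + h *: e).
    have [/derivable1_diffP/differentiable_continuous + _] := is_derive_affine (q t) e (0 : R).
    rewrite /prop_for/continuous_at.
    rewrite line0.
    by apply; exact: open_nbhs_nbhs.
  apply: filterS => h Bh; rewrite LE// (diff_rV _ (ds _ Bh)).
  by [].
have Dw : is_derive (0 : R) 1 w (\sum_c u 0 c *: 'D_e ('D_(delta_mx 0 c) sigma) (q t)).
  apply: is_derive_sumf => c; rewrite -[in X in is_derive _ _ _ X]line0.
  by apply: is_deriveZ; apply: is_derive_line; rewrite line0; exact: (Ds c).1.
have Dy : is_derive (0 : R) 1 (fun h => sigma (q t + h *: e)) ('D_e sigma (q t)).
  rewrite -[in X in is_derive _ _ _ X]line0.
  by apply: is_derive_line; rewrite line0; exact: ds.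
have w0 : w 0 = 'd sigma (q t) u by rewrite /w line0 -diff_rV//; exact: ds.
have [dG dU] := dGU _ Bt.
have dG0 a c : differentiable (G a c) (sigma (q t + (0 : R) *: e)) by rewrite line0.
have dU0 : differentiable U (sigma (q t + (0 : R) *: e)) by rewrite line0.
apply: is_derive_eq (is_derive_lagrangian Gsym
  (q := fun h : R => sigma (q t + h *: e)) (t := 0 : R) dG0 dU0 Dy Dw) _.
rewrite line0.
apply: eq_bigr => a _; rewrite w0; congr (_ + _); congr (_ * _).
refine (congr1 (fun m : 'rV[R]_n => m 0 a) _).
apply: etrans (esym (diff_rV u dDs)); apply: eq_bigr => c _.
by rewrite /e (Ck_on_Schwarz b c oB Bt C2s).
Qed.

End change_of_chart.

(** * Local existence of motions with given initial data *)

Section local_existence.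
Context {R : realType}.

Lemma bounded_diff_det (V : normedModType R) m (M : V -> 'M[R]_m) x0 :
  (forall i j, bounded_diff (fun x => M x i j) x0) -> bounded_diff (fun x => \det (M x)) x0.
Proof.
move=> bM; rewrite /determinant; apply: bounded_diff_sum => s _.
by apply: bounded_diffM; [exact: bounded_diff_cst|apply: bounded_diff_prod => i _; exact: bM].
Qed.

Lemma bounded_diff_adj (V : normedModType R) m (M : V -> 'M[R]_m) x0 i j :
  (forall i j, bounded_diff (fun x => M x i j) x0) -> bounded_diff (fun x => (\adj (M x)) i j) x0.
Proof.
move=> bM; under eq_fun do rewrite mxE /cofactor.
apply: bounded_diffM; first exact: bounded_diff_cst.
apply: bounded_diff_det => k l; under eq_fun do rewrite !mxE; exact: bM.
Qed.

Lemma bounded_diff_lipschitz_rV (V : normedModType R) m (f : V -> 'rV[R]_m) x0 :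
  (forall j, bounded_diff (fun x => f x 0 j) x0) ->
  exists2 L : R, 0 <= L & \forall r \near 0^'+, forall x y,
    ball x0 r x -> ball x0 r y -> `|f x - f y| <= L * `|x - y|.
Proof.
move=> bf; have H j := bounded_diff_lipschitz (bf j).
(* [choice] expects a plain existential, hence the conversion from [exists2]. *)
have [L HL] := choice (fun j => let: ex_intro2 L a b := H j in ex_intro
  (fun L : R => 0 <= L /\ \forall r \near 0^'+, forall x y,
    ball x0 r x -> ball x0 r y -> `|f x 0 j - f y 0 j| <= L * `|x - y|) L (conj a b)).
have L0 : 0 <= \sum_j L j by apply: sumr_ge0 => j _; exact: (HL j).1.
exists (\sum_j L j) => //; near=> r => x y xr yr.
apply: rV_norm_le => [|j]; first by rewrite mulr_ge0.
rewrite !mxE; apply: (@le_trans _ _ (L j * `|x - y|)).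
  move: x y xr yr; move: j; near: r; apply: filter_forall => j.
  exact: (HL j).2.
rewrite ler_wpM2r// (bigD1 j)//= lerDl sumr_ge0// => i _; exact: (HL i).1.
Unshelve. all: by end_near. Qed.

(** Once the momentum equation is solved for the acceleration, the second-order system is an
    ordinary differential equation for the pair (y, w), packed in one row of length n + n, to which
    [picard] applies. *)
Lemma local_motion n (G : 'I_n -> 'I_n -> 'rV[R]_n -> R) (U : 'rV[R]_n -> R)
    (dU : 'I_n -> 'rV[R]_n -> R) (A : set 'rV[R]_n) (y0 w0 : 'rV[R]_n) :
  open A -> A y0 -> (forall a b, Ck_on 2 A (G a b)) ->
  \det (\matrix_(a, b) G a b y0) != 0 ->
  (forall a, bounded_diff (dU a) y0) ->
  (forall y a, A y -> 'D_(delta_mx 0 a) U y = dU a y) ->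
  exists2 T : R, 0 < T & exists q w dw : R -> 'rV[R]_n,
    [/\ q 0 = y0, w 0 = w0 & forall t : R, `|t| < T ->
      [/\ A (q t), is_derive t 1 q (w t), is_derive t 1 w (dw t),
          {for t, continuous dw} & forall a, is_derive t 1
            (fun s => momentum G (q s) (w s) a) (force G U (q t) (w t) a)]].
Proof.
move=> oA Ay0 CG detG bdU DU.
pose x0 : 'rV[R]_(n + n) := row_mx y0 w0.
pose Y (x : 'rV[R]_(n + n)) : 'rV[R]_n := lsubmx x.
pose W (x : 'rV[R]_(n + n)) : 'rV[R]_n := rsubmx x.
have Y0 : Y x0 = y0 by rewrite /Y row_mxKl.
have W0 : W x0 = w0 by rewrite /W row_mxKr.
have bY : bounded_diff Y x0.
  exact: (@bounded_diff_lin _ _ _ (@lsubmx R 1 n n) _ (@continuous_lsubmx _ _ _ _)).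
have bW : bounded_diff W x0.
  exact: (@bounded_diff_lin _ _ _ (@rsubmx R 1 n n) _ (@continuous_rsubmx _ _ _ _)).
have bYc (f : 'rV[R]_n -> R) : bounded_diff f y0 -> bounded_diff (fun x => f (Y x)) x0.
  by move=> bf; apply: (bounded_diff_comp bY); rewrite Y0.
have bWc a : bounded_diff (fun x => W x 0 a) x0 by exact: bounded_diff_coord.
have bG a b : bounded_diff (G a b) y0 by apply: (Ck_on_bounded_diff oA Ay0); exact/Ck_onS/CG.
have bDG a b c : bounded_diff ('D_(delta_mx 0 c) (G a b)) y0.
  by apply: (Ck_on_bounded_diff oA Ay0); exact: (CG a b).2.
pose M y := \matrix_(a, b) G a b y.
(* Cramer's rule, so that the inverse of the Gram matrix is visibly smooth. *)
pose Ginv a b y := (\det (M y))^-1 * (\adj (M y)) a b.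
have bM a b : bounded_diff (fun y => M y a b) y0.
  by under eq_fun do rewrite mxE; exact: bG.
have bdetM : bounded_diff (fun y => \det (M y)) y0 by exact: bounded_diff_det.
have bGinv a b : bounded_diff (Ginv a b) y0.
  by apply: bounded_diffM; [exact: bounded_diffV|exact: bounded_diff_adj].
(* The force minus the part of the derivative of the momentum due to the variation of [G] along the
   motion: what is left must be the [momentum] of the acceleration. *)
pose K a (x : 'rV[R]_(n + n)) :=
  ((\sum_b \sum_c 'D_(delta_mx 0 a) (G b c) (Y x) * W x 0 c * W x 0 b) / 2
    + - dU a (Y x)) +
  - (\sum_b \sum_c 'D_(delta_mx 0 c) (G a b) (Y x) * W x 0 c * W x 0 b).
have bDGW a b c d e :
    bounded_diff (fun x => 'D_(delta_mx 0 a) (G b c) (Y x) * W x 0 d * W x 0 e) x0.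
  apply: (@bounded_diffM _ _ (fun x => 'D_(delta_mx 0 a) (G b c) (Y x) * W x 0 d)) => //.
  apply: (@bounded_diffM _ _ (fun x => 'D_(delta_mx 0 a) (G b c) (Y x))) => //.
  exact: (bYc _ (bDG b c a)).
have bK a : bounded_diff (K a) x0.
  rewrite /K; apply: bounded_diffD.
    apply: bounded_diffD; last by apply: bounded_diffN; exact: bYc.
    apply: bounded_diffM; last exact: bounded_diff_cst.
    by apply: bounded_diff_sum => b _; apply: bounded_diff_sum => c _.
  by apply: bounded_diffN; apply: bounded_diff_sum => b _; apply: bounded_diff_sum => c _.
pose Phi x : 'rV[R]_n := \row_a \sum_b Ginv a b (Y x) * K b x.
have bPhi a : bounded_diff (fun x => Phi x 0 a) x0.
  under eq_fun do rewrite mxE.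
  apply: bounded_diff_sum => b _.
  by apply: (@bounded_diffM _ _ (fun x => Ginv a b (Y x))) => //; exact: (bYc _ (bGinv a b)).
pose f x : 'rV[R]_(n + n) := row_mx (W x) (Phi x).
have bf j : bounded_diff (fun x => f x 0 j) x0.
  rewrite /f; case: (split_ordP j) => a ->.
    by under eq_fun do rewrite row_mxEl.
  by under eq_fun do rewrite row_mxEr.
have [L L0 fL] := bounded_diff_lipschitz_rV bf.
(* The Lipschitz bound for [Phi] alone gives the continuity of the acceleration. *)
have [L' L'0 fL'] := bounded_diff_lipschitz_rV bPhi.
have nA : \forall x \near x0, A (Y x).
  by apply: (bounded_diff_continuous bY); rewrite Y0; exact: open_nbhs_nbhs.
have ndet : \forall x \near x0, \det (M (Y x)) != 0.
  have := bounded_diff_continuous (bYc _ bdetM) => /cvgr_neq0; apply.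
  by rewrite Y0.
have [r [r0 fr Phir Ar]] : exists r, [/\ 0 < r,
    (forall x y, ball x0 r x -> ball x0 r y -> `|f x - f y| <= L * `|x - y|),
    (forall x y, ball x0 r x -> ball x0 r y -> `|Phi x - Phi y| <= L' * `|x - y|) &
    (forall x, ball x0 r x -> A (Y x) /\ \det (M (Y x)) != 0)].
  have [/= d d0 Hd] := (nbhs_ballP _ _).1 (filterI nA ndet).
  have : \forall r \near (0 : R)^'+, [/\ 0 < r,
    (forall x y, ball x0 r x -> ball x0 r y -> `|f x - f y| <= L * `|x - y|),
    (forall x y, ball x0 r x -> ball x0 r y -> `|Phi x - Phi y| <= L' * `|x - y|) &
    (forall x, ball x0 r x -> A (Y x) /\ \det (M (Y x)) != 0)].
    near=> r; split; [by []|by near: r|by near: r|].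
    move=> x xr; apply: Hd; apply: le_ball xr.
    by near: r; exact: nbhs_right_le.
  by move=> /filter_ex[r Hr]; exists r.
have [T T0 [x x00 Hx]] := picard r0 L0 fr.
have Dq (t : R) : `|t| < T -> is_derive t 1 (Y \o x) (W (x t)).
  move=> tT; have [_ Dx] := Hx t tT.
  apply: is_derive_rV => a; have := is_derive_coord (lshift n a) Dx.
  rewrite row_mxEl; congr (is_derive _ _ _ _).
  by apply/funext => s; rewrite /= mxE.
have Dw (t : R) : `|t| < T -> is_derive t 1 (W \o x) (Phi (x t)).
  move=> tT; have [_ Dx] := Hx t tT.
  apply: is_derive_rV => a; have := is_derive_coord (rshift n a) Dx.
  rewrite row_mxEr; congr (is_derive _ _ _ _).
  by apply/funext => s; rewrite /= mxE.
exists T => //; exists (Y \o x), (W \o x), (Phi \o x).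
split; rewrite /= ?x00 ?Y0 ?W0// => t tT.
have [xtr Dx] := Hx t tT; have [Ay dety] := Ar _ xtr.
split => //; [exact: Dq|exact: Dw| |].
  apply: continuous_comp; last exact: (lipschitz_ball_continuous L'0 Phir).
  by apply/differentiable_continuous/derivable1_diffP; have [] := Dx.
move=> a.
have dG b : differentiable (G a b) ((Y \o x) t) by exact: (CG a b).1.
apply: is_derive_eq (is_derive_momentum dG (Dq _ tT) (Dw _ tT)) _.
rewrite /= /force DU//.
have -> : momentum G (Y (x t)) (Phi (x t)) a = K a (x t).
  have GGinv b : \sum_c G a c (Y (x t)) * Ginv c b (Y (x t)) = (a == b)%:R.
    rewrite /Ginv; under eq_bigr do rewrite mulrCA.
    rewrite -mulr_sumr (_ : \sum_c _ = (M (Y (x t)) *m \adj (M (Y (x t)))) a b).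
      by rewrite mul_mx_adj mxE -[_ *+ _]mulr_natr mulrA mulVf ?mul1r.
    by rewrite [RHS]mxE; apply: eq_bigr => c _; congr (_ * _); rewrite mxE.
  rewrite /momentum; under eq_bigr do rewrite mxE mulr_sumr.
  rewrite exchange_big/=.
  under eq_bigr do [under eq_bigr do rewrite mulrA; rewrite -mulr_suml GGinv].
  by rewrite (bigD1 a)//= eqxx mul1r big1 ?addr0// => b ba; rewrite eq_sym (negbTE ba) mul0r.
rewrite /K; set S := \sum_b \sum_c 'D_(delta_mx 0 c) (G a b) (Y (x t)) * W (x t) 0 c * W (x t) 0 b.
rewrite (_ : \sum_b 'd (G a b) (Y (x t)) (W (x t)) * W (x t) 0 b = S).
  by rewrite addrC subrK.
apply: eq_bigr => b _; rewrite (diff_rV _ (dG b)) mulr_suml.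
by apply: eq_bigr => c _; rewrite [_ *: _]mulrC.
Unshelve. all: by end_near. Qed.

End local_existence.

(** * Escape of slow motions from a fixed ball *)

Section escape.
Context {R : realType}.

Lemma mvt_ge (f df : R -> R) (c T : R) : 0 <= T ->
  (forall t : R, 0 <= t -> t <= T -> is_derive t 1 f (df t)) ->
  (forall t, 0 <= t -> t <= T -> c <= df t) -> f 0 + c * T <= f T.
Proof.
move=> T0 Df dfc; rewrite addrC -lerBrDr.
have [] := @MVT_segment _ f df 0 T T0.
- by move=> t; rewrite in_itv/= => /andP[t0 t1]; apply: Df; exact: ltW.
- apply: derivable_within_continuous => t; rewrite in_itv/= => /andP[t0 t1].
  by have [] := Df t t0 t1.
move=> t; rewrite in_itv/= subr0 => /andP[t0 t1] ->.
by rewrite ler_wpM2r// dfc.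
Qed.

Lemma near_sum_dist_le (V : normedModType R) (I : finType) (f : I -> V -> R)
    (x0 : V) (e : R) :
  (forall i, {for x0, continuous (f i)}) -> 0 < e ->
  \forall x \near x0, \sum_i `|f i x0 - f i x| <= e.
Proof.
move=> cf e0; pose d := e / (#|I|%:R + 1).
have I1 : 0 < #|I|%:R + 1 :> R by rewrite ltr_wpDl.
have d0 : 0 < d by rewrite divr_gt0.
near=> x.
apply: (@le_trans _ _ (\sum_(i : I) d)).
  apply: ler_sum => i _; move: i; near: x; apply: filter_forall => i.
  by move/cvgrPdist_le : (cf i); exact.
rewrite sumr_const -mulr_natr /d mulrAC ler_pdivrMr// ler_pM2l//.
by rewrite lerDl.
Unshelve. all: by end_near. Qed.

Lemma bounded_diff_family (V W : normedModType R) (I : finType) (f : I -> V -> W) x0 :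
  (forall i, bounded_diff (f i) x0) -> exists2 C : R, 0 <= C &
    \forall x \near x0, forall i, [/\ differentiable (f i) x, `|f i x| <= C &
      forall v, `|'d (f i) x v| <= C * `|v|].
Proof.
move=> /choice[C HC]; exists (\sum_i `|C i|); first exact: sumr_ge0.
near=> x => i.
have [df fC dfC] : [/\ differentiable (f i) x, `|f i x| <= C i &
    forall v, `|'d (f i) x v| <= C i * `|v|].
  by move: i; near: x; apply: filter_forall => i; exact: HC.
have Ci : C i <= \sum_i `|C i|.
  by rewrite (bigD1 i)//= (le_trans (ler_norm _))// lerDl sumr_ge0.
split => //; first exact: le_trans Ci.
by move=> v; rewrite (le_trans (dfC v))// ler_wpM2r.
Unshelve. all: by end_near. Qed.

Lemma sum_normM_le n (f g : 'I_n -> R) (C D : R) :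
  (forall i, `|f i| <= C) -> (forall i, `|g i| <= D) ->
  `|\sum_i f i * g i| <= n%:R * (C * D).
Proof.
move=> fC gD; rewrite (le_trans (ler_norm_sum _ _ _))//.
apply: (@le_trans _ _ (\sum_(i < n) C * D)).
  by apply: ler_sum => i _; rewrite normrM ler_pM.
by rewrite sumr_const card_ord mulr_natl.
Qed.

(** By homogeneity of degree 2, the constant is the minimum of [kinetic G y] over the unit sphere,
    which is compact. *)
Lemma coercive n (G : 'I_n -> 'I_n -> 'rV[R]_n -> R) (y : 'rV[R]_n) :
  (forall w, w != 0 -> 0 < kinetic G y w) ->
  exists2 c : R, 0 < c & forall w, c * `|w| ^+ 2 <= kinetic G y w.
Proof.
move=> pos; pose S := [set w : 'rV[R]_n | `|w| = 1].
have unitS w : w != 0 -> S (`|w|^-1 *: w).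
  by move=> w0; rewrite /S/= normrZ normfV normr_id mulVf// normr_eq0.
have kinZ (a : R) w : kinetic G y (a *: w) = a ^+ 2 * kinetic G y w.
  rewrite /kinetic mulr_sumr; apply: eq_bigr => b _.
  rewrite /momentum !mulr_suml mulr_sumr; apply: eq_bigr => c _.
  by rewrite !mxE expr2; ring.
have kin0 : kinetic G y 0 = 0 by rewrite -(scale0r 0) kinZ expr0n mul0r.
(* When n = 0 the sphere is empty and every vector is zero. *)
have [SN0|/set0P/negP/negPn/eqP S0] := pselect (S !=set0); last first.
  exists 1 => // w; have [->|w0] := eqVneq w 0; first by rewrite kin0 normr0 expr0n mulr0.
  by have := unitS w w0; rewrite S0.
have cS : compact S.
  apply: bounded_closed_compact.
    exists 1; split => // M M1 w; rewrite /S/= => ->; exact: ltW.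
  rewrite (_ : S = (fun w : 'rV[R]_n => `|w|) @^-1` [set (1 : R)])//.
  apply: preimage_closed; last exact: closed_eq.
  by move=> w _; exact: norm_continuous.
have ck : {within S, continuous (kinetic G y)}.
  apply: continuous_subspaceT => w; apply: bounded_diff_continuous.
  have bid : bounded_diff (fun u : 'rV[R]_n => u) w.
    by apply: (@bounded_diff_lin _ _ _ idfun) => u; exact: cvg_id.
  apply: bounded_diff_sum => a _; apply: bounded_diffM; last exact: bounded_diff_coord.
  by apply: bounded_diff_sum => b _; apply: bounded_diffM;
    [exact: bounded_diff_cst|exact: bounded_diff_coord].
have [w Sw wmin] := EVT_min_rV SN0 cS ck.
have w0 : w != 0.
  by move: Sw; rewrite inE/= => Sw; apply: contra_eq_neq Sw => ->; rewrite normr0 eq_sym oner_eq0.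
exists (kinetic G y w); first exact: pos.
move=> u; have [->|u0] := eqVneq u 0; first by rewrite kin0 normr0 expr0n mulr0.
have un0 : `|u| != 0 by rewrite normr_eq0.
have := wmin (`|u|^-1 *: u) (mem_set (unitS _ u0)).
by rewrite kinZ exprVn mulrC ler_pdivlMr// exprn_gt0// normr_gt0.
Qed.

(** The radius [r] is chosen before [e], so that the initial velocity [e *: xi y0] may be as small
    as desired. The constants below serve three estimates: |w| <= K e, |A'| <= C2 e^2 and |A - B'|
    <= c0v e / 4. *)
Lemma escape n (G : 'I_n -> 'I_n -> 'rV[R]_n -> R) (U : 'rV[R]_n -> R)
    (xi : 'rV[R]_n -> 'rV[R]_n) (y0 : 'rV[R]_n) :
  (forall a b y, G a b y = G b a y) ->
  (forall a b, bounded_diff (G a b) y0) -> (forall w, w != 0 -> 0 < kinetic G y0 w) ->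
  U y0 = 0 ->
  (\forall y \near y0, [/\ differentiable U y, 0 <= U y & 'd U y (xi y) = 0]) ->
  (forall a, bounded_diff (fun y => xi y 0 a) y0) -> xi y0 != 0 ->
  exists2 r : R, 0 < r & forall (e : R) (q w dw : R -> 'rV[R]_n),
    0 < e -> q 0 = y0 -> w 0 = e *: xi y0 ->
    ~ (forall t, 0 <= t -> [/\ ball y0 r (q t), is_derive t 1 q (w t),
        is_derive t 1 w (dw t) & forall a, is_derive t 1
            (fun s => momentum G (q s) (w s) a) (force G U (q t) (w t) a)]).
Proof.
move=> Gsym bG Gpos U0 nU bxi v0; set v := xi y0 in v0 *.
have [c c0 cG] := coercive Gpos.
pose G2 (p : 'I_n * 'I_n) := G p.1 p.2.
have bG2 p : bounded_diff (G2 p) y0 by exact: bG.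
have [C C0 nC] := bounded_diff_family bG2.
have [D D0 nD] := bounded_diff_family bxi.
(* The covector dual to [xi] for the metric; [A] below is its pairing with the velocity. *)
pose eta b y := \sum_a xi y 0 a * G a b y.
have beta b : bounded_diff (eta b) y0 by apply: bounded_diff_sum => a _; apply: bounded_diffM.
pose c0v := kinetic G y0 v.
have c0v0 : 0 < c0v by exact: Gpos.
(* Energy gives (c / 2) |w|^2 <= c0v e^2; the inequality x <= (x + 1)^2 for x >= 0 then spares a
   square root. *)
pose K := 2 * c0v / c + 1.
have K0' : 0 <= 2 * c0v / c by rewrite divr_ge0 ?mulr_ge0// ltW.
have K0 : 0 < K by rewrite /K; lra.
have c20 : 0 < c / 2 by rewrite divr_gt0.
have d0 : 0 < c0v / 4 / K by rewrite !divr_gt0.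
have nG := near_sum_dist_le (fun p => bounded_diff_continuous (bG2 p)) c20.
have neta := near_sum_dist_le (fun b => bounded_diff_continuous (beta b)) d0.
pose N : R := n%:R.
have N0 : 0 <= N by [].
(* [C1] bounds |A'| / |w|^2: its first term comes from the derivative of [xi], the second from half
   the derivative of [G] along [xi]. *)
pose C1 := N * (D * (N * C)) + N * (N * (C * D)) / 2.
pose C2 := C1 * K ^+ 2 + 1.
have C10 : 0 <= C1 by rewrite addr_ge0 ?divr_ge0 ?mulr_ge0.
have C20 : 0 < C2 by rewrite ltr_wpDl// mulr_ge0// sqr_ge0.
pose Ce := \sum_b `|eta b y0|.
have Ce0 : 0 <= Ce by exact: sumr_ge0.
(* In the ball of radius [rho] the displacement [B] is at most c0v^2 / (16 C2), half of what it must
   reach at the time [T] below. *)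
pose rho := c0v ^+ 2 / (16 * C2) / (Ce + 1).
have Ce1 : 0 < Ce + 1 by lra.
have rho0 : 0 < rho by rewrite !divr_gt0 ?exprn_gt0 ?mulr_gt0.
have [r [r0 rrho Hr]] : exists r : R, [/\ 0 < r, r <= rho & forall y, ball y0 r y ->
    [/\ [/\ differentiable U y, 0 <= U y & 'd U y (xi y) = 0],
      forall p, [/\ differentiable (G2 p) y, `|G2 p y| <= C &
         forall u, `|'d (G2 p) y u| <= C * `|u|],
      forall a, [/\ differentiable (fun y => xi y 0 a) y, `|xi y 0 a| <= D &
         forall u, `|'d (fun y => xi y 0 a) y u| <= D * `|u|],
      \sum_p `|G2 p y0 - G2 p y| <= c / 2 &
      \sum_b `|eta b y0 - eta b y| <= c0v / 4 / K]].
  have : \forall y \near y0, [/\ [/\ differentiable U y, 0 <= U y & 'd U y (xi y) = 0],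
      forall p, [/\ differentiable (G2 p) y, `|G2 p y| <= C &
         forall u, `|'d (G2 p) y u| <= C * `|u|],
      forall a, [/\ differentiable (fun y => xi y 0 a) y, `|xi y 0 a| <= D &
         forall u, `|'d (fun y => xi y 0 a) y u| <= D * `|u|],
      \sum_p `|G2 p y0 - G2 p y| <= c / 2 &
      \sum_b `|eta b y0 - eta b y| <= c0v / 4 / K].
    by near=> y; split; near: y.
  move=> /nbhs_ballP[d /= dd Hd]; exists (Num.min d rho); split.
  - by rewrite lt_min dd.
  - by rewrite ge_min lexx orbT.
  - by move=> y yr; apply: Hd; apply: le_ball yr; rewrite ge_min lexx.
exists r => // e q w dw e0 q0 w0 H.
have Hq t (t0 : 0 <= t) := let: And4 a _ _ _ := H t t0 in Hr _ a.
(* The energy [<p, w> - L], as the Legendre transform: its derivative vanishes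
   without using the form of [L]. *)
pose E t := kinetic G (q t) (w t) - lagrangian G U (q t) (w t).
have DE (t : R) : 0 <= t -> is_derive t 1 E 0.
  move=> t0; have [_ Dq Dw Dm] := H t t0; have [[dU _ _] dG _ _ _] := Hq t t0.
  have dG' a b : differentiable (G a b) (q t) by have [] := dG (a, b).
  have D1 a := is_derive_mulf (Dm a) (is_derive_coord a Dw).
  apply: is_derive_eq (is_deriveB (is_derive_sumf D1)
    (is_derive_lagrangian Gsym dG' dU Dq Dw)) _.
  by rewrite subrr.
have E0 : E 0 = e ^+ 2 * c0v / 2.
  rewrite /E /lagrangian q0 w0 U0 subr0.
  have -> : kinetic G y0 (e *: v) = e ^+ 2 * c0v.
    rewrite /c0v /kinetic mulr_sumr; apply: eq_bigr => a _.
    rewrite /momentum !mulr_suml mulr_sumr; apply: eq_bigr => b _.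
    by rewrite !mxE expr2; ring.
  by rewrite {1}(splitr (e ^+ 2 * c0v)) addrK.
have Et t : 0 <= t -> E t <= E 0.
  move=> t0; have := @mvt_ge (fun s => - E s) (fun=> 0) 0 t t0.
  rewrite mul0r addr0 lerN2; apply => // s s0 _.
  by apply: is_derive_eq (is_deriveN (DE _ s0)) _; rewrite oppr0.
have wK t : 0 <= t -> `|w t| <= K * e.
  move=> t0; have [[_ U_ge0 _] _ _ nGt _] := Hq t t0.
  (* Since [U] is nonnegative, the kinetic energy is at most the total energy. *)
  have kinle : kinetic G (q t) (w t) <= e ^+ 2 * c0v.
    by have := Et t t0; rewrite E0 /E /lagrangian; lra.
  (* In the small ball the metric keeps at least half of its coercivity constant at [y0]. *)
  have kinge : c / 2 * `|w t| ^+ 2 <= kinetic G (q t) (w t).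
    have := cG (w t).
    have : kinetic G y0 (w t) - kinetic G (q t) (w t) <= c / 2 * `|w t| ^+ 2.
      apply: (@le_trans _ _ ((\sum_p `|G2 p y0 - G2 p (q t)|) * `|w t| ^+ 2)); last first.
        by rewrite ler_wpM2r// sqr_ge0.
      rewrite mulr_suml -(pair_bigA _ (fun a b => `|G a b y0 - G a b (q t)| * `|w t| ^+ 2))/=.
      rewrite /kinetic -sumrB; apply: ler_sum => a _.
      rewrite -mulrBl /momentum -sumrB mulr_suml; apply: ler_sum => b _.
      rewrite -mulrBl -mulrA (le_trans (ler_norm _))// !normrM ler_wpM2l//.
      by rewrite expr2 ler_pM//; exact: ler_coord_norm.
    lra.
  rewrite -(@ler_pXn2r _ 2)// ?nnegrE ?mulr_ge0 ?(ltW K0) ?(ltW e0)//.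
  have : `|w t| ^+ 2 <= 2 * c0v / c * e ^+ 2.
    rewrite mulrAC ler_pdivlMr//; lra.
  move=> /le_trans; apply; rewrite exprMn ler_wpM2r ?sqr_ge0//.
  rewrite /K; nra.
have momle t a : 0 <= t -> `|momentum G (q t) (w t) a| <= N * (C * `|w t|).
  move=> t0; have [_ nGt _ _ _] := Hq t t0.
  apply: sum_normM_le => b; first by have [] := nGt (a, b).
  exact: ler_coord_norm.
(* The momentum along [xi], on which the potential does not act. *)
pose A t := \sum_a xi (q t) 0 a * momentum G (q t) (w t) a.
pose dA t := \sum_a ('d (fun y => xi y 0 a) (q t) (w t) * momentum G (q t) (w t) a +
                    xi (q t) 0 a * force G U (q t) (w t) a).
have DA (t : R) : 0 <= t -> is_derive t 1 A (dA t).
  move=> t0; have [_ Dq Dw Dm] := H t t0; have [_ _ dxi _ _] := Hq t t0.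
  apply: is_derive_sumf => a; apply: is_derive_mulf => //.
  have [dxa _ _] := dxi a.
  exact: (is_derive_diff_comp dxa Dq).
(* The potential term is dU(xi) = 0; half the derivative of the metric along [xi] remains. *)
have xiforce t : 0 <= t -> \sum_a xi (q t) 0 a * force G U (q t) (w t) a =
    (\sum_b (\sum_c 'd (G b c) (q t) (xi (q t)) * w t 0 c) * w t 0 b) / 2.
  move=> t0; have [[dU _ dUxi] dG _ _ _] := Hq t t0.
  under eq_bigr do rewrite /force mulrBr.
  rewrite sumrB [X in _ - X](_ : _ = 0) ?subr0; last first.
    by apply: etrans dUxi; rewrite (diff_rV _ dU).
  under eq_bigr do rewrite mulrA.
  rewrite -mulr_suml; congr (_ / 2).
  under eq_bigr do rewrite mulr_sumr.
  rewrite exchange_big/=; apply: eq_bigr => b _.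
  under eq_bigr do rewrite mulr_sumr.
  rewrite exchange_big/= mulr_suml; apply: eq_bigr => d _.
  have [dGbd _ _] := dG (b, d).
  rewrite (diff_rV _ dGbd) !mulr_suml; apply: eq_bigr => a _.
  by rewrite !mulrA.
have dAle t : 0 <= t -> `|dA t| <= C1 * `|w t| ^+ 2.
  move=> t0; have [_ dG dxi _ _] := Hq t t0.
  rewrite /dA big_split/= xiforce// (le_trans (ler_normD _ _))// mulrDl lerD//.
    apply: (@le_trans _ _ (N * ((D * `|w t|) * (N * (C * `|w t|))))).
      apply: sum_normM_le => a; last exact: momle.
      by have [_ _ ->] := dxi a.
    by rewrite le_eqVlt; apply/orP; left; apply/eqP; rewrite expr2; ring.
  have xiD : `|xi (q t)| <= D.
    by apply: rV_norm_le => // a; have [] := dxi a.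
  rewrite normrM [X in _ * X <= _]ger0_norm ?invr_ge0// mulrAC ler_wpM2r ?invr_ge0//.
  apply: (@le_trans _ _ (N * ((N * ((C * D) * `|w t|)) * `|w t|))); last first.
    by rewrite le_eqVlt; apply/orP; left; apply/eqP; rewrite expr2; ring.
  apply: sum_normM_le => b; last exact: ler_coord_norm.
  apply: sum_normM_le => d; last exact: ler_coord_norm.
  have [_ _ /(_ (xi (q t)))/le_trans] := dG (b, d); apply.
  by rewrite ler_wpM2l.
have A0 : A 0 = e * c0v.
  rewrite /A q0 w0 /c0v /kinetic mulr_sumr; apply: eq_bigr => a _.
  rewrite /momentum mulr_sumr mulr_suml mulr_sumr; apply: eq_bigr => b _.
  by rewrite !mxE -/v; ring.
have Age t : 0 <= t -> e * c0v - C2 * e ^+ 2 * t <= A t.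
  move=> t0; rewrite -A0 -mulNr; apply: (mvt_ge t0) => s s0 _; first exact: DA.
  have := dAle s s0.
  have : C1 * `|w s| ^+ 2 <= C2 * e ^+ 2.
    apply: (@le_trans _ _ (C1 * (K * e) ^+ 2)).
      by rewrite ler_wpM2l// ler_pXn2r ?nnegrE ?mulr_ge0 ?(ltW K0) ?(ltW e0)//; exact: wK.
    by rewrite exprMn mulrA ler_wpM2r ?sqr_ge0// /C2; lra.
  have := ler_norm (- dA s); rewrite normrN; lra.
(* The displacement in the direction of [v]; its derivative is close to [A]. *)
pose B t := \sum_b eta b y0 * (q t - y0) 0 b.
pose dB t := \sum_b eta b y0 * w t 0 b.
have DB (t : R) : 0 <= t -> is_derive t 1 B (dB t).
  move=> t0; have [_ Dq _ _] := H t t0; apply: is_derive_sumf => b.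
  have Dqy : is_derive t 1 (fun s => q s - y0) (w t).
    by apply: is_derive_eq (is_deriveB Dq (is_derive_cst y0 t 1)) _; rewrite subr0.
  have := is_derive_mulf (is_derive_cst (eta b y0) t 1) (is_derive_coord b Dqy).
  by rewrite mul0r add0r.
have AB t : 0 <= t -> `|A t - dB t| <= c0v / 4 * e.
  move=> t0; have [_ _ _ _ neta_t] := Hq t t0.
  have -> : A t = \sum_b eta b (q t) * w t 0 b.
    rewrite /A /eta; under eq_bigr do rewrite /momentum mulr_sumr.
    rewrite exchange_big/=; apply: eq_bigr => b _; rewrite mulr_suml.
    by apply: eq_bigr => a _; rewrite mulrA.
  rewrite distrC /dB -sumrB.
  apply: (@le_trans _ _ ((\sum_b `|eta b y0 - eta b (q t)|) * (K * e))); last first.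
    apply: (@le_trans _ _ (c0v / 4 / K * (K * e))).
      by rewrite ler_wpM2r// mulr_ge0// ltW.
    by rewrite mulrA divfK// gt_eqF.
  rewrite (le_trans (ler_norm_sum _ _ _))// mulr_suml; apply: ler_sum => b _.
  rewrite -mulrBl normrM ler_wpM2l// (le_trans (ler_coord_norm _ _))//.
  exact: wK.
(* Up to this time [A], which starts at e c0v, loses at most half of its initial value, so [dB] is
   at least e c0v / 4. *)
pose T := c0v / (2 * C2 * e).
have Ce20 : 0 < 2 * C2 * e by rewrite !mulr_gt0.
have T0 : 0 <= T by rewrite divr_ge0// ltW.
have dBge t : 0 <= t -> t <= T -> e * c0v / 4 <= dB t.
  move=> t0 tT; have := Age t t0; have := AB t t0.
  have : C2 * e ^+ 2 * t <= e * c0v / 2.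
    apply: (@le_trans _ _ (C2 * e ^+ 2 * T)).
      by rewrite ler_wpM2l// mulr_ge0 ?sqr_ge0// ltW.
    rewrite le_eqVlt; apply/orP; left; apply/eqP; rewrite /T.
    by field; rewrite !gt_eqF.
  have := ler_norm (A t - dB t); lra.
have BT := mvt_ge T0 (fun t t0 _ => DB t t0) dBge.
have B0 : B 0 = 0.
  by rewrite /B q0 subrr big1// => b _; rewrite mxE mulr0.
have BTle : B T <= Ce * r.
  rewrite (le_trans (ler_norm _))// (le_trans (ler_norm_sum _ _ _))// mulr_suml.
  apply: ler_sum => b _; rewrite normrM ler_wpM2l// (le_trans (ler_coord_norm _ _))//.
  have [+ _ _ _] := H T T0.
  by rewrite -ball_normE/= distrC => /ltW.
have : Ce * r <= c0v ^+ 2 / (16 * C2).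
  apply: (@le_trans _ _ ((Ce + 1) * rho)).
    by apply: ler_pM => //; [exact: ltW|lra].
  by rewrite mulrC /rho divfK// gt_eqF.
have eT : e * c0v / 4 * T = c0v ^+ 2 / (16 * C2) * 2.
  by rewrite /T; field; rewrite !gt_eqF.
have c16 : 0 < c0v ^+ 2 / (16 * C2) by rewrite divr_gt0 ?exprn_gt0 ?mulr_gt0.
move: BT; rewrite B0 add0r eT; lra.
Unshelve. all: by end_near. Qed.

(** As k < n, the Jacobian at [y0] has a nonzero kernel vector [v]. Surjectivity provides [M] with
    [M *m J y0 = 1%:M], and [v] is corrected to stay in the kernel nearby, with [xi y0 = v]. *)
Lemma level_field n k (f : 'rV[R]_n -> 'rV[R]_k) (A : set 'rV[R]_n) y0 :
  (k < n)%N -> open A -> A y0 -> Ck_on 2 A f ->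
  (forall u, exists w, 'd f y0 w = u) ->
  exists xi : 'rV[R]_n -> 'rV[R]_n,
    [/\ forall a, bounded_diff (fun y => xi y 0 a) y0, xi y0 != 0 &
        forall y, A y -> 'd f y (xi y) = 0].
Proof.
move=> kn oA Ay0 [df Df] surj.
pose J y : 'M[R]_(n, k) := \matrix_(a, b) 'D_(delta_mx 0 a) f y 0 b.
have dJ y w : A y -> 'd f y w = w *m J y.
  move=> Ay; rewrite (diff_rV _ (df _ Ay)); apply/rowP => b.
  by rewrite summxE mxE; apply: eq_bigr => a _; rewrite !mxE.
have [v vJ v0] : exists2 v : 'rV[R]_n, v *m J y0 = 0 & v != 0.
  have kerN0 : kermx (J y0) != 0.
    rewrite -mxrank_eq0 mxrank_ker subn_eq0 -ltnNge.
    by apply: leq_ltn_trans kn; exact: rank_leq_col.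
  by have [v /sub_kermxP vJ v0] := rowV0Pn kerN0; exists v.
have [S HS] := choice surj.
pose M : 'M[R]_(k, n) := \matrix_(b, a) S (delta_mx 0 b) 0 a.
have MJ : M *m J y0 = 1%:M.
  apply/row_matrixP => b; rewrite row_mul row1.
  rewrite (_ : row b M = S (delta_mx 0 b)) -?dJ//.
  by apply/rowP => a; rewrite !mxE.
(* By Cramer's rule this is [det D] times the projection of [v] to the kernel of
   [dF] along the row space of [M], where [D = M *m J y]. *)
pose xi y := \det (M *m J y) *: v - v *m J y *m \adj (M *m J y) *m M.
have bJ a b : bounded_diff (fun y => J y a b) y0.
  under eq_fun do rewrite mxE; apply: bounded_diff_coord.
  by apply: (Ck_on_bounded_diff oA Ay0); exact: Df.
have bMJ b c : bounded_diff (fun y => (M *m J y) b c) y0.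
  under eq_fun do rewrite mxE; apply: bounded_diff_sum => a _.
  by apply: bounded_diffM; [exact: bounded_diff_cst|exact: bJ].
exists xi; split.
- move=> a; under eq_fun do rewrite !mxE.
  apply: bounded_diffD.
    by apply: bounded_diffM; [exact: bounded_diff_det|exact: bounded_diff_cst].
  apply: bounded_diffN; apply: bounded_diff_sum => b _.
  apply: bounded_diffM; last exact: bounded_diff_cst.
  under eq_fun do rewrite mxE; apply: bounded_diff_sum => c _.
  apply: bounded_diffM; last exact: bounded_diff_adj.
  under eq_fun do rewrite mxE; apply: bounded_diff_sum => d _.
  by apply: bounded_diffM; [exact: bounded_diff_cst|exact: bJ].
- by rewrite /xi MJ det1 scale1r vJ !mul0mx subr0.
(* The product of the adjugate of D with D is det D even for singular D, so the field is in the
   kernel on all of [A]. *)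
- move=> y Ay; apply: (etrans (dJ _ _ Ay)); rewrite /xi mulmxBl -scalemxAl -!mulmxA mul_adj_mx.
  by rewrite mul_mx_scalar scalemxAr subrr.
Qed.

End escape.

(** * Charts and the tangent bundle *)

Section topology_helpers.

Lemma open_setI_preimage (X Y : topologicalType) (f : X -> Y) (A : set X) (O : set Y) :
  open A -> (forall x, A x -> {for x, continuous f}) -> open O ->
  open (A `&` f @^-1` O).
Proof.
move=> oA cf oO; rewrite openE => x [Ax Ox]; apply: filterI.
  exact: open_nbhs_nbhs.
by apply: (cf x Ax); exact: open_nbhs_nbhs.
Qed.

Lemma continuous_rV (R : realType) (T : topologicalType) n (f : T -> 'rV[R]_n) x :
  (forall a, {for x, continuous (fun s => f s 0 a)}) -> {for x, continuous f}.
Proof.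
move=> cf; apply/cvgrPdist_le => e e0; near=> s.
apply: rV_norm_le => [|a]; first exact: ltW.
rewrite !mxE; move: a; near: s; apply: filter_forall => a.
by move/cvgrPdist_le : (cf a); exact.
Unshelve. all: by end_near. Qed.

Lemma near_norm_lt (R : realType) (T t : R) : `|t| < T -> \forall s \near t, `|s| < T.
Proof. by move=> tT; exact: cvgr_norm_lt (@cvg_id _ (nbhs t)) _ tT. Qed.

End topology_helpers.

(** * Polarization of a quadratic form on the tangent spaces *)

Section quadratic.
Context {R : realType} {n : nat} (N : smooth_manifold R n).
Variable Q : forall x : N, tangent x -> R.
Hypothesis qQ : quadratic_form Q.

Lemma polarC x (u v : tangent x) : polar Q u v = polar Q v u.
Proof.
rewrite /polar (_ : (u : 'rV[R]_n) + v = (v : 'rV[R]_n) + u); last by rewrite addrC.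
by rewrite addrAC.
Qed.

Lemma polar_diag x (v : tangent x) : polar Q v v = 2 * Q v.
Proof.
have [QZ _] := qQ x; rewrite /polar.
have -> : (v : 'rV[R]_n) + v = 2 *: (v : 'rV[R]_n) by rewrite scalerDl scale1r.
by rewrite QZ; ring.
Qed.

Lemma polar_suml x m (c : 'I_m -> R) (u : 'I_m -> tangent x) (v : tangent x) :
  polar Q (\sum_i c i *: (u i : 'rV[R]_n)) v = \sum_i c i * polar Q (u i) v.
Proof.
have [QZ Qlin] := qQ x.
have p0 : polar Q (0 : 'rV[R]_n) v = 0.
  rewrite /polar add0r (_ : Q (0 : 'rV[R]_n) = 0) ?subr0 ?subrr//.
  by have := QZ 0 v; rewrite scale0r => ->; rewrite expr0n mul0r.
elim/big_ind2 : _ => //.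
- move=> a A b B <- <-.
  by have := Qlin 1 A B v; rewrite scale1r mul1r.
- move=> i _; have := Qlin (c i) (u i) 0 v; rewrite addr0 => ->.
  by rewrite p0 addr0.
Qed.

End quadratic.

(** * Transition maps and components of tangent vectors *)

Section charts.
Context {R : realType} {n : nat} {N : smooth_manifold R n}.
Implicit Types (i j l : atlas_index N) (x : N).

Definition overlap i j : set 'rV[R]_n :=
  chart_cod (atlas i) `&` psi (atlas i) @^-1` chart_dom (atlas j).

Definition transition i j : 'rV[R]_n -> 'rV[R]_n := phi (atlas j) \o psi (atlas i).

Lemma overlap_open i j : open (overlap i j).
Proof.
apply: open_setI_preimage; [exact: chart_cod_open| |exact: chart_dom_open].
by move=> y; exact: psi_continuous.
Qed.

Lemma transition_smooth m i j : Ck_on m (overlap i j) (transition i j).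
Proof. exact: atlas_smooth. Qed.

Lemma transition_differentiable i j y :
  overlap i j y -> differentiable (transition i j) y.
Proof. by have [d _] := transition_smooth 1 i j; exact: d. Qed.

Lemma psi_transition i j y :
  overlap i j y -> psi (atlas j) (transition i j y) = psi (atlas i) y.
Proof. by move=> [_ yj]; rewrite /transition/= phiK. Qed.

Lemma transition_overlap i j y : overlap i j y -> overlap j i (transition i j y).
Proof.
move=> ijy; split; first by case: ijy => _; exact: phi_cod.
rewrite /preimage/= [psi _ _]psi_transition//; case: ijy => iy _.
exact: psi_dom.
Qed.

(** This is the chain rule; as the composite of two transitions equals the third one only near [y],
    the derivatives are compared through local equality. *)
Lemma transition_cocycle i j l y w : overlap i j y -> overlap i l y ->
  'd (transition j l) (transition i j y) ('d (transition i j) y w) =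
  'd (transition i l) y w.
Proof.
move=> ijy ily; have dij := transition_differentiable ijy.
have jly : overlap j l (transition i j y).
  have [jy _] := transition_overlap ijy; split => //.
  by rewrite /preimage/= [psi _ _]psi_transition//; case: ily.
have djl := transition_differentiable jly.
have dil := transition_differentiable ily.
have dcomp : differentiable (transition j l \o transition i j) y.
  exact: differentiable_comp.
apply: etrans (esym (congr1 (fun h => h w) (diff_comp dij djl))) _.
apply: etrans (esym (deriveE w dcomp)) _; apply: etrans _ (deriveE w dil).
apply: near_eq_derive.
have : \forall z \near y, overlap i j z by apply: open_nbhs_nbhs; split => //; exact: overlap_open.
by apply: filterS => z ijz; rewrite /= /transition/= [psi _ (_ (_ z))]psi_transition.
Qed.

Lemma transition_id i y w : chart_cod (atlas i) y -> 'd (transition i i) y w = w.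
Proof.
move=> iy; have iiy : overlap i i y by split => //; exact: psi_dom.
apply: etrans (esym (deriveE w (transition_differentiable iiy))) _.
apply: etrans _ (derive_id y w); apply: near_eq_derive.
have : \forall z \near y, chart_cod (atlas i) z.
  by apply: open_nbhs_nbhs; split => //; exact: chart_cod_open.
by apply: filterS => z iz; rewrite /transition/= psiK.
Qed.

Lemma chart_atP x : chart_dom (chart_at x) x.
Proof. exact: svalP (cid (atlas_cover x)). Qed.

Lemma tvecE i y w : tvec i y w =
  'd (transition i (sval (cid (atlas_cover (psi (atlas i) y))))) y w :> 'rV[R]_n.
Proof. by []. Qed.

(** The differential of the transition back to the chart [i] is a left inverse of [tvec i y]. *)
Lemma tvec_inj i y w : chart_cod (atlas i) y -> tvec i y w = 0 :> 'rV[R]_n -> w = 0.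
Proof.
move=> iy; rewrite tvecE; set l := sval _ => E.
have ily : overlap i l y by split => //; exact: chart_atP.
have iiy : overlap i i y by split => //; exact: psi_dom.
apply: etrans (esym (transition_id w iy)) _.
apply: etrans (esym (transition_cocycle w ily iiy)) _.
exact: etrans (congr1 _ E) (linear0 _).
Qed.

(** The two base points [psi (atlas j) (transition i j y)] and [psi (atlas i) y] are equal but not
    convertible; an equality under an arbitrary family [q] avoids transporting tangent vectors from
    one to the other. *)
Lemma tvec_transition (T : Type) (q : forall x : N, tangent x -> T) i j y w :
  overlap i j y ->
  q _ (tvec j (transition i j y) ('d (transition i j) y w)) = q _ (tvec i y w).
Proof.
move=> ijy; have E := psi_transition ijy.
pose l := sval (cid (atlas_cover (psi (atlas i) y))).
have H x : x = psi (atlas i) y ->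
    q x ('d (phi (chart_at x) \o psi (atlas j)) (transition i j y) ('d (transition i j) y w)) =
    q (psi (atlas i) y) (tvec i y w).
  move=> ->; congr (q _ _).
  apply: (@transition_cocycle i j l) => //.
  by split; [case: ijy|exact: chart_atP].
exact: H.
Qed.

End charts.

(** * The mechanical Lagrangian in a chart *)

Section local_lagrangian.
Context {R : realType} {n : nat} {N : smooth_manifold R n}.
Variables (Q : forall x : N, tangent x -> R) (U : N -> R).
Hypothesis qQ : quadratic_form Q.

Definition gram i a b y :=
  polar Q (tvec i y (delta_mx 0 a)) (tvec i y (delta_mx 0 b)).

Lemma gramC i a b y : gram i a b y = gram i b a y.
Proof. exact: polarC. Qed.

(** Bilinear expansion of [polar Q] on the coordinate vectors; the factor 2 is that of
    [polar_diag]. *)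
Lemma kinetic_gram i y w : kinetic (gram i) y w = 2 * Q (tvec i y w).
Proof.
rewrite -(polar_diag qQ).
have E : tvec i y w = \sum_a w 0 a *: (tvec i y (delta_mx 0 a) : 'rV[R]_n) :> 'rV[R]_n.
  rewrite {1}(row_sum_delta w) /tvec linear_sum; apply: eq_bigr => a _.
  by rewrite linearZ.
rewrite {1}E (polar_suml qQ) /kinetic; apply: eq_bigr => a _.
rewrite mulrC; congr (_ * _).
rewrite [RHS]polarC E (polar_suml qQ) /momentum; apply: eq_bigr => b _.
by rewrite mulrC; congr (_ * _); exact: gramC.
Qed.

Definition mechanical : forall x : N, tangent x -> R := fun x v => Q v - U x.

Lemma local_lagrangianE i y w :
  local_lagrangian mechanical i y w = lagrangian (gram i) (U \o psi (atlas i)) y w.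
Proof.
rewrite /local_lagrangian /mechanical /lagrangian kinetic_gram.
by rewrite [2 * _]mulrC mulfK ?pnatr_eq0.
Qed.

Lemma local_lagrangian_transition (L : forall x : N, tangent x -> R) i j y w :
  overlap j i y ->
  local_lagrangian L j y w = local_lagrangian L i (transition j i y) ('d (transition j i) y w).
Proof. by move=> jiy; rewrite /local_lagrangian (tvec_transition L). Qed.

End local_lagrangian.

(** * Mechanical motions on the manifold and in its charts *)

Section mechanical_motion.
Context {R : realType} {n : nat} {N : smooth_manifold R n}.
Variables (Q : forall x : N, tangent x -> R) (U : N -> R).
Hypothesis qQ : quadratic_form Q.
Hypothesis CQ : Ck_form 2 Q.
Hypothesis dU : forall i y, chart_cod (atlas i) y ->
  differentiable (U \o psi (atlas i)) y.

Local Notation L := (mechanical Q U).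

Lemma gram_smooth i a b : Ck_on 2 (chart_cod (atlas i)) (gram Q i a b).
Proof. exact: CQ. Qed.

Lemma derive_mechanical_velocity i y w a :
  'D_(delta_mx 0 a) (local_lagrangian L i y) w = momentum (gram Q i) y w a.
Proof.
have -> : local_lagrangian L i y = lagrangian (gram Q i) (U \o psi (atlas i)) y.
  by apply/funext => v; exact: local_lagrangianE.
by apply: derive_lagrangian_velocity => *; exact: gramC.
Qed.

Lemma derive_mechanical_position i y w a : chart_cod (atlas i) y ->
  'D_(delta_mx 0 a) (fun z => local_lagrangian L i z w) y =
  force (gram Q i) (U \o psi (atlas i)) y w a.
Proof.
move=> iy; have -> : (fun z => local_lagrangian L i z w) =
    (lagrangian (gram Q i) (U \o psi (atlas i)))^~ w.
  by apply/funext => v; exact: local_lagrangianE.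
apply: derive_lagrangian_position => //; first by move=> *; exact: gramC.
  by move=> b c; exact: (gram_smooth i b c).1.
exact: dU.
Qed.

Lemma EL_solution_momentum c J t i a :
  EL_solution L c J -> J t -> chart_dom (atlas i) (c t) ->
  let q : R -> 'rV[R]_n := phi (atlas i) \o c in
  is_derive t 1 (fun s => momentum (gram Q i) (q s) (q^`()%classic s) a)
    (force (gram Q i) (U \o psi (atlas i)) (q t) (q^`()%classic t) a).
Proof.
move=> [_ EL] Jt ict q; have := EL t Jt i ict a; rewrite /= -/q.
rewrite derive_mechanical_position; last exact: phi_cod.
by under eq_fun do rewrite derive_mechanical_velocity.
Qed.

(** * A motion found in one chart, seen in all charts *)

Section chart_motion.
Variables (i : atlas_index N) (T : R) (q w dw : R -> 'rV[R]_n).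
Hypothesis q_cod : forall t : R, `|t| < T -> chart_cod (atlas i) (q t).
Hypothesis Dq : forall t : R, `|t| < T -> is_derive t 1 q (w t).
Hypothesis Dw : forall t : R, `|t| < T -> is_derive t 1 w (dw t).
Hypothesis cdw : forall t : R, `|t| < T -> {for t, continuous dw}.
Hypothesis Dm : forall (t : R) a, `|t| < T ->
  is_derive t 1 (fun s => momentum (gram Q i) (q s) (w s) a)
    (force (gram Q i) (U \o psi (atlas i)) (q t) (w t) a).

Lemma lift_chart_motion (t : R) : `|t| < T ->
  Defs.lift (psi (atlas i) \o q) t = bundle_chart i (q t, w t).
Proof.
move=> tT; rewrite /Defs.lift /bundle_chart/=; congr TPoint.
rewrite /velocity derive1E.
pose l := sval (cid (atlas_cover (psi (atlas i) (q t)))).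
have ilq : overlap i l (q t) by split; [exact: q_cod|exact: chart_atP].
by have [_ E] := is_derive_diff_comp (transition_differentiable ilq) (Dq tT); exact: E.
Qed.

Let S j : set R := [set t | `|t| < T /\ overlap i j (q t)].

Let qc t : `|t| < T -> {for t, continuous q}.
Proof.
by move=> tT; apply/differentiable_continuous/derivable1_diffP; have [] := Dq tT.
Qed.

Let wc t : `|t| < T -> {for t, continuous w}.
Proof.
by move=> tT; apply/differentiable_continuous/derivable1_diffP; have [] := Dw tT.
Qed.

Let S_nbhs j t : S j t -> \forall s \near t, S j s.
Proof.
move=> [tT ijt]; apply: filterI; first exact: near_norm_lt.
by apply: (qc tT); apply: open_nbhs_nbhs; split => //; exact: overlap_open.
Qed.

(** [v1] and [v2] are the velocity and the acceleration in the chart [j], written with partial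
    derivatives of the transition so that their derivability or continuity can be read off. *)
Let v1 j t : 'rV[R]_n := \sum_a w t 0 a *: 'D_(delta_mx 0 a) (transition i j) (q t).

Let v2 j t : 'rV[R]_n := \sum_a
  (dw t 0 a *: 'D_(delta_mx 0 a) (transition i j) (q t) +
   w t 0 a *: \sum_b w t 0 b *:
     'D_(delta_mx 0 b) ('D_(delta_mx 0 a) (transition i j)) (q t)).

Let D1 j t : S j t -> is_derive t 1 (transition i j \o q) (v1 j t).
Proof.
move=> [tT ijt]; have d := transition_differentiable ijt.
apply: is_derive_eq (is_derive_diff_comp d (Dq tT)) _.
exact: diff_rV.
Qed.

Let D2 j t : S j t -> is_derive t 1 (v1 j) (v2 j t).
Proof.
move=> [tT ijt]; have [_ dd] := transition_smooth 2 i j.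
apply: is_derive_rV => e.
rewrite (_ : (fun s => _) = fun s => \sum_a w s 0 a *
    ('D_(delta_mx 0 a) (transition i j) \o q) s 0 e); last first.
  by apply/funext => s; rewrite summxE; apply: eq_bigr => a _; rewrite mxE.
rewrite summxE; apply: is_derive_sumf => a.
have da := (dd a).1 _ ijt.
have := is_derive_mulf (is_derive_coord a (Dw tT))
  (is_derive_coord e (is_derive_diff_comp da (Dq tT))).
move=> H; apply: is_derive_eq H _.
rewrite !mxE; congr (_ + _ * _).
by refine (congr1 (fun m : 'rV[R]_n => m 0 e) _); exact: diff_rV.
Qed.

Let v2c j t : S j t -> {for t, continuous (v2 j)}.
Proof.
move=> [tT ijt]; have [_ dd] := transition_smooth 2 i j.
have coordc (u : R -> 'rV[R]_n) b : {for t, continuous u} ->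
    {for t, continuous (fun s => u s 0 b)}.
  by move=> cu; apply: (continuous_comp (g := fun m : 'rV[R]_n => m 0 b)) => //;
     exact: coord_continuous.
have trc a : {for t, continuous (fun s => 'D_(delta_mx 0 a) (transition i j) (q s))}.
  apply: (@continuous_comp _ _ _ q ('D_(delta_mx 0 a) (transition i j))).
    exact: qc.
  exact/differentiable_continuous/(dd a).1.
have trcc a b : {for t, continuous
    (fun s => 'D_(delta_mx 0 b) ('D_(delta_mx 0 a) (transition i j)) (q s))}.
  apply: (@continuous_comp _ _ _ q ('D_(delta_mx 0 b) ('D_(delta_mx 0 a) (transition i j)))).
    exact: qc.
  exact: (dd a).2.
apply: continuous_rV => e.
rewrite (_ : (fun s => _) = fun s => \sum_a
  (dw s 0 a * 'D_(delta_mx 0 a) (transition i j) (q s) 0 e +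
   w s 0 a * \sum_b w s 0 b *
     'D_(delta_mx 0 b) ('D_(delta_mx 0 a) (transition i j)) (q s) 0 e)); last first.
  apply/funext => s; rewrite summxE; apply: eq_bigr => a _; rewrite !mxE summxE.
  by congr (_ + _ * _); apply: eq_bigr => b _; rewrite mxE.
apply: cvg_big => [|a _]; first exact: add_continuous.
apply: cvgD; apply: cvgM; [exact: (coordc _ _ (cdw tT))|exact: (coordc _ _ (trc a))|
  exact: (coordc _ _ (wc tT))|].
apply: cvg_big => [|b _]; first exact: add_continuous.
by apply: cvgM; [exact: (coordc _ _ (wc tT))|exact: (coordc _ _ (trcc a b))].
Qed.

(** The formulas [v1] and [v2] give the C^2 regularity in every chart [j]. The equations hold in the
    chart [i] by hypothesis, and pass to [j] by the transition from [j] to [i]. *)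
Lemma chart_motion_EL_solution :
  EL_solution L (psi (atlas i) \o q) [set t | `|t| < T].
Proof.
have St j t : `|t| < T -> chart_dom (atlas j) (psi (atlas i) (q t)) -> S j t.
  by move=> tT jt; split => //; split => //; exact: q_cod.
have E1 j t : S j t -> (transition i j \o q)^`()%classic t = v1 j t.
  by move=> /D1[_ <-]; rewrite derive1E.
have D2' j t : S j t -> is_derive t 1 (transition i j \o q)^`()%classic (v2 j t).
  move=> Sjt; apply: near_eq_is_derive (D2 Sjt).
  by apply: filterS (S_nbhs Sjt) => s Sjs; rewrite E1.
split.
  move=> t tT; split.
    apply: continuous_comp; first exact: qc.
    by apply: psi_continuous; exact: q_cod.
  move=> j jt; have Sjt := St _ _ tT jt; split.
  - by have [] := D1 Sjt.
  - by have [] := D2' _ _ Sjt.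
  - have E2 s : S j s -> (transition i j \o q)^`()%classic^`()%classic s = v2 j s.
      by move=> /D2'[_ <-]; rewrite derive1E.
    rewrite /prop_for/continuous_at [X in _ --> X](E2 _ Sjt).
    apply: cvg_trans (v2c Sjt); apply: near_eq_cvg.
    by apply: filterS (S_nbhs Sjt) => s Sjs; rewrite E2.
move=> t tT j jt qj qj' b; have Sjt := St _ _ tT jt.
apply: (@Euler_Lagrange_change_chart R n (gram Q i) (U \o psi (atlas i))
  (fun a c y => gramC Q i a c y) (overlap j i) (transition j i) (local_lagrangian L j) qj).
- exact: overlap_open.
- exact: transition_smooth.
- by move=> y u jiy; rewrite (local_lagrangian_transition _ _ jiy) local_lagrangianE.
- move=> y jiy; have [iz _] := transition_overlap jiy.
  by split=> [c d|]; [exact: (gram_smooth i c d).1|exact: dU].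
- apply: filterS (S_nbhs Sjt) => s [_ ijs]; exact: transition_overlap.
- by have [] := D1 Sjt.
(* The motion seen in the chart [j] and its velocity, brought back to the chart [i], are [q] and
   [w]. *)
have Es s : S j s -> transition j i (qj s) = q s /\
    'd (transition j i) (qj s) (qj^`()%classic s) = w s.
  move=> Sjs; have [sT ijs] := Sjs; split.
    by rewrite /transition/= [psi _ _](psi_transition ijs) psiK//; exact: q_cod.
  have iis : overlap i i (q s) by split; [exact: q_cod|exact/psi_dom/q_cod].
  rewrite (_ : qj^`()%classic s = 'd (transition i j) (q s) (w s)).
    apply: etrans (transition_cocycle _ ijs iis) _.
    by apply: transition_id; exact: q_cod.
  apply: etrans (E1 _ _ Sjs) _; apply/esym; apply: diff_rV.
  exact: transition_differentiable.
move=> a; have [Eq Ew] := Es t Sjt.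
apply: is_derive_eq _ (esym (congr2 (fun y u =>
  force (gram Q i) (U \o psi (atlas i)) y u a) Eq Ew)).
apply: near_eq_is_derive (Dm a tT).
apply: filterS (S_nbhs Sjt) => s Sjs; have [Eqs Ews] := Es s Sjs.
exact: esym (congr2 (fun y u => momentum (gram Q i) y u a) Eqs Ews).
Qed.

End chart_motion.

(** The constant curve at [p] is a solution: at zero velocity the momentum vanishes and the force
    reduces to -dU, which is zero at a minimum. *)
Lemma mechanical_equilibrium p : (forall x, U p <= U x) ->
  equilibrium L (TPoint p 0).
Proof.
move=> pmin; exists (cst p).
have d0 i : (phi (atlas i) \o cst p : R -> 'rV[R]_n)^`()%classic = cst 0.
  by apply/funext => t; rewrite derive1E [_ \o _](_ : _ = cst (phi (atlas i) p))// derive_cst.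
have d00 : (cst 0 : R -> 'rV[R]_n)^`()%classic = cst 0.
  by apply/funext => t; rewrite derive1E derive_cst.
split; last first.
  move=> t; rewrite /Defs.lift; congr TPoint.
  exact: (congr1 (fun h => h t) (d0 (sval (cid (atlas_cover p))))).
split.
  move=> t _; split; first exact: cvg_cst.
  move=> i ip q q'; rewrite /q' /q d0 d00; split.
  - exact: (derivable_cst (phi (atlas i) p)).
  - exact: (derivable_cst (0 : 'rV[R]_n)).
  - exact: cvg_cst.
move=> t _ i ip q q' a; have Eq' : q' = cst 0 by exact: d0.
have iq : chart_cod (atlas i) (phi (atlas i) p) by exact: phi_cod.
rewrite derive_mechanical_position// Eq'.
have m0 y b : momentum (gram Q i) y 0 b = 0.
  by rewrite /momentum big1// => c _; rewrite mxE mulr0.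
rewrite (_ : (fun s => _) = cst 0); last first.
  by apply/funext => s; rewrite derive_mechanical_velocity m0.
rewrite (_ : force _ _ _ _ _ = 0); first exact: is_derive_cst.
rewrite /force big1 => [|b _]; last first.
  by rewrite big1// => c _; rewrite mxE mulr0 mul0r.
rewrite mul0r sub0r derive_at_min ?oppr0//.
  have : \forall z \near phi (atlas i) p, chart_cod (atlas i) z.
    by apply: open_nbhs_nbhs; split => //; exact: chart_cod_open.
  by apply: filterS => z iz; exact: dU.
by move=> z; rewrite /= phiK.
Qed.

End mechanical_motion.

(** * Neighborhoods in the tangent bundle *)

Section bundle_neighborhoods.
Context {R : realType} {n : nat} {N : smooth_manifold R n}.

(** Only the base point is constrained, so in every bundle chart the set is a cylinder over an open
    set. *)
Lemma nbhs_bundle_base (i : atlas_index N) (X : tangent_bundle N) (r : R) :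
  chart_dom (atlas i) (tbase X) -> 0 < r ->
  nbhs X [set Y : tangent_bundle N | chart_dom (atlas i) (tbase Y) /\
     ball (phi (atlas i) (tbase X)) r (phi (atlas i) (tbase Y))].
Proof.
move=> iX r0; apply: open_nbhs_nbhs; split; last first.
  by split => //; exact: ballxx.
set y0 := phi _ _; pose V := chart_dom (atlas i) `&` phi (atlas i) @^-1` ball y0 r.
have oV : open V.
  apply: open_setI_preimage; [exact: chart_dom_open| |exact: ball_open].
  by move=> x; exact: phi_continuous.
move=> j; rewrite (_ : [set z | _] =
  fst @^-1` (chart_cod (atlas j) `&` psi (atlas j) @^-1` V)).
  apply: open_comp => [z _|]; first exact: cvg_fst.
  apply: open_setI_preimage => //; first exact: chart_cod_open.
  by move=> y; exact: psi_continuous.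
by [].
Qed.

(** In the bundle chart, the curve of parameter [e] is continuous and passes at [e = 0] through the
    zero vector over [p], so small positive values of [e] suit. *)
Lemma nbhs_bundle_small (i : atlas_index N) p (O : set (tangent_bundle N)) (v : 'rV[R]_n) :
  chart_dom (atlas i) p -> nbhs (TPoint p 0) O ->
  exists2 e : R, 0 < e & O (bundle_chart i (phi (atlas i) p, e *: v)).
Proof.
move=> ip; rewrite nbhsE => -[B [oB Bp] BO].
have E : bundle_chart i (phi (atlas i) p, 0) = TPoint p 0.
  rewrite /bundle_chart/= (_ : tvec i (phi (atlas i) p) 0 = (0 : 'rV[R]_n)).
    (* The base point is generalized first, since the zero tangent vector has a type that depends on
       it. *)
    by have : psi (atlas i) (phi (atlas i) p) = p by [exact: phiK]; move: (psi _ _) => x ->.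
  exact: linear0.
pose Z := [set z | chart_cod (atlas i) z.1 /\ B (bundle_chart i z)].
have oZ : open Z by exact: oB.
have nZ : nbhs (phi (atlas i) p, (0 : R) *: v) Z.
  apply: open_nbhs_nbhs; split => //; split; first exact: phi_cod.
  by rewrite scale0r E.
have cz : {for (0 : R), continuous (fun e : R => (phi (atlas i) p, e *: v))}.
  apply: differentiable_continuous; apply: differentiable_pair.
    exact: differentiable_cst.
  by apply: differentiableZl.
have /nbhs_ballP[d /= d0 Hd] := cz _ nZ.
exists (d / 2); first by rewrite divr_gt0.
apply: BO; have [] // := Hd (d / 2).
by rewrite /ball/= sub0r normrN ger0_norm ?divr_ge0 ?ltW//; lra.
Qed.

End bundle_neighborhoods.

(** * Instability of the zero set of the potential *)

Theorem corollary1 (R : realType) (n k : nat) (N : smooth_manifold R n)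
    (Q : forall x : N, tangent x -> R) (g : 'rV[R]_k -> R) (F : N -> 'rV[R]_k) :
  quadratic_form Q -> positive_definite Q -> Ck_form 2 Q ->
  (1 <= k)%N -> (k < n)%N ->
  Ck_on 2 setT g ->
  (forall z, 0 <= g z) -> (forall z, g z = 0 <-> z = 0) ->
  Ck 3 F -> regular_value F 0 ->
  let Fc (a : 'I_k) : N -> R := fun x => F x 0 a in
  (forall a b : 'I_k,
    commute_on (~` critical (Fc a) `&` ~` critical (Fc b))
      (normalized_grad Q (Fc a)) (normalized_grad Q (Fc b))) ->
  (forall a b : 'I_k, a != b ->
    forall x, polar Q (grad Q (Fc a) x) (grad Q (Fc b) x) = 0) ->
  let U : N -> R := g \o F in
  let M : set N := U @^-1` [set 0] in
  let Lmech : forall x : N, tangent x -> R := fun x v => Q x v - U x in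
  forall p, M p ->
    equilibrium Lmech (TPoint p 0) /\ lyapunov_unstable Lmech (TPoint p 0).
Proof.
move=> qQ pQ CQ _ kn Cg g0 gz CF regF Fc _ _ U M Lmech p Mp.
have dg z : differentiable g z by exact: Cg.1.
have dF i y : chart_cod (atlas i) y -> differentiable (F \o psi (atlas i)) y.
  by move=> iy; exact: (CF i).1.
have dU i y : chart_cod (atlas i) y -> differentiable (U \o psi (atlas i)) y.
  by move=> iy; apply: (@differentiable_comp _ _ _ _ (F \o psi (atlas i)) g); [exact: dF|exact: dg].
have Up : U p = 0 by [].
split; first by apply: mechanical_equilibrium => // x; rewrite Up; exact: g0.
move=> stable.
pose i := sval (cid (atlas_cover p)).
have ip : chart_dom (atlas i) p by exact: chart_atP.
pose y0 := phi (atlas i) p.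
have iy0 : chart_cod (atlas i) y0 by exact: phi_cod.
have psiy0 : psi (atlas i) y0 = p by exact: phiK.
pose f := F \o psi (atlas i).
pose Ui := U \o psi (atlas i).
have ocod : open (chart_cod (atlas i)) by exact: chart_cod_open.
have surj u : exists w, 'd f y0 w = u.
  (* As [g] vanishes only at the origin, [F p = 0], and the regularity of the value 0 applies at
     [p]. *)
  have Fp : F p = 0 by apply/gz.
  exact: (regF p Fp u).
have [xi [bxi xi0 dxi]] := level_field kn ocod iy0 (Ck_onS (CF i)) surj.
(* The differential of [U] factors through that of [F], so it vanishes on [xi]. *)
have dUE y w : chart_cod (atlas i) y -> 'd Ui y w = 'd g (f y) ('d f y w).
  move=> iy; exact: (congr1 (fun h => h w) (diff_comp (dF i y iy) (dg (f y)))).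
have bG a b : bounded_diff (gram Q i a b) y0.
  by apply: (Ck_on_bounded_diff ocod iy0); exact/Ck_onS/CQ.
have Gpos y w : chart_cod (atlas i) y -> w != 0 -> 0 < kinetic (gram Q i) y w.
  move=> iy w0; rewrite kinetic_gram// mulr_gt0// pQ//.
  by apply: contra_neq w0; exact: tvec_inj.
have ncod : \forall y \near y0, chart_cod (atlas i) y by exact: open_nbhs_nbhs.
have Uy0 : Ui y0 = 0 by rewrite /Ui/= psiy0.
have nU : \forall y \near y0, [/\ differentiable Ui y, 0 <= Ui y & 'd Ui y (xi y) = 0].
  apply: filterS ncod => y iy; split; [exact: dU|exact: g0|].
  apply: etrans (dUE _ _ iy) _; apply: etrans (congr1 _ (dxi _ iy)) _; exact: linear0.
have [r r0 Hr] := @escape R n (gram Q i) Ui xi y0 (fun a b y => gramC Q i a b y) bG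
    (fun w => Gpos y0 w iy0) Uy0 nU bxi xi0.
(* Stability is tested on the neighborhood that confines positions to the escape ball and leaves
   velocities free. *)
have [V nV HV] := stable _ (@nbhs_bundle_base _ _ _ i (TPoint p 0) r ip r0).
have [e e0 Ve] := nbhs_bundle_small (xi y0) ip nV.
(* The partial derivatives of [U] by the chain rule; they inherit bounded differentials from the
   first derivatives of [F] and [g]. *)
pose dUi a y := 'd g (f y) ('D_(delta_mx 0 a) f y).
have bdUi a : bounded_diff (dUi a) y0.
  rewrite /dUi (_ : (fun y => _) = fun y => \sum_b 'D_(delta_mx 0 a) f y 0 b *
      'D_(delta_mx 0 b) g (f y)); last by apply/funext => y; exact: diff_rV.
  have bf : bounded_diff f y0 by apply: (Ck_on_bounded_diff ocod iy0); exact/Ck_onS/Ck_onS/CF.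
  apply: bounded_diff_sum => b _; apply: bounded_diffM.
    apply: bounded_diff_coord; apply: (Ck_on_bounded_diff ocod iy0).
    by apply: Ck_onS; exact: (CF i).2.
  have bDg : bounded_diff ('D_(delta_mx 0 b) g) (f y0).
    by apply: (@Ck_on_bounded_diff _ _ _ setT) => //; [exact: openT|exact: Cg.2].
  exact: (bounded_diff_comp bf bDg).
have DUi y a : chart_cod (atlas i) y -> 'D_(delta_mx 0 a) Ui y = dUi a y.
  move=> iy; apply: etrans (deriveE _ (dU i y iy)) _; apply: etrans (dUE _ _ iy) _.
  by rewrite /dUi (deriveE _ (dF i y iy)).
(* A vector in the kernel of the Gram matrix has zero kinetic energy, hence is zero. *)
have detG : \det (\matrix_(a, b) gram Q i a b y0) != 0.
  suff : \matrix_(a, b) gram Q i a b y0 \in unitmx by rewrite unitmxE unitfE.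
  rewrite -row_free_unit -kermx_eq0.
  apply/rowV0P => w /sub_kermxP wG; apply/eqP; apply: contraTT isT => w0.
  have := Gpos y0 w iy0 w0; rewrite /kinetic big1 ?ltxx// => a _.
  have := congr1 (fun m : 'rV[R]_n => m 0 a) wG; rewrite !mxE => wGa.
  rewrite (_ : momentum _ _ _ _ = 0) ?mul0r// -[RHS]wGa.
  by apply: eq_bigr => b _; rewrite mxE mulrC gramC.
have [T T0 [q [w [dw [q0 w0 Hq]]]]] := @local_motion R n (gram Q i) Ui dUi
  (chart_cod (atlas i)) y0 (e *: xi y0) ocod iy0 (CQ i) detG bdUi DUi.
pose J : set R := [set t | `|t| < T].
have J0 : J 0 by rewrite /J/= normr0.
have q_cod (t : R) : `|t| < T -> chart_cod (atlas i) (q t) by move=> /Hq[].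
have Dq (t : R) : `|t| < T -> is_derive t 1 q (w t) by move=> /Hq[].
have Dw (t : R) : `|t| < T -> is_derive t 1 w (dw t) by move=> /Hq[].
have ELc : EL_solution Lmech (psi (atlas i) \o q) J.
  apply: (chart_motion_EL_solution qQ CQ dU q_cod Dq Dw).
  - by move=> t /Hq[].
  - by move=> t a /Hq[].
have Jnbhs t : J t -> \forall s \near t, J s by exact: near_norm_lt.
have oJ : open J by rewrite openE => t Jt; exact: Jnbhs.
have intJ : is_interval J.
  move=> x y; rewrite /J/= !ltr_norml => /andP[x1 x2] /andP[y1 y2] z /andP[xz zy].
  by rewrite ltr_norml (lt_le_trans x1 xz) (le_lt_trans zy y2).
have lift0 : V (Defs.lift (psi (atlas i) \o q) 0).
  rewrite (lift_chart_motion q_cod Dq) ?normr0//.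
  by rewrite q0 w0.
have [c' [ELc' c'c Oc']] := HV J _ oJ intJ J0 ELc lift0.
pose q1 : R -> 'rV[R]_n := phi (atlas i) \o c'.
have q1q t : J t -> q1 t = q t.
  by move=> Jt; rewrite /q1/= c'c// psiK//; exact: q_cod.
(* Stability extends the local motion to a solution [c'] that stays over the escape ball for all t
   >= 0. It coincides with the local motion near time 0, so its initial data are [y0] and
   [e *: xi y0], which [escape] excludes. *)
apply: (Hr e q1 q1^`()%classic q1^`()%classic^`()%classic e0).
- by rewrite q1q.
- rewrite derive1E -w0; have [_ <-] := Dq 0 J0.
  by apply: near_eq_derive; apply: filterS (Jnbhs 0 J0) => s Js; rewrite q1q.
move=> t t0; have [ict rct] := Oc' t t0.
have Jt : (J `|` [set t | 0 <= t]) t by right.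
have [_ /(_ i ict)[d1 d2 _]] := ELc'.1 t Jt.
have dD (h : R -> 'rV[R]_n) : derivable h t 1 -> is_derive t 1 h (h^`()%classic t).
  by move=> dh; rewrite derive1E; exact: derivableP.
split; [exact: rct|exact: dD|exact: dD|move=> a].
exact: (EL_solution_momentum qQ CQ dU a ELc' Jt ict).
Qed.
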